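(* Suppose that $\beta\in L^{1}(\mathbb{R})$ and that $\beta'=\mu$ is a finite Borel measure on $\mathbb{R}$, with point values $\beta(x)=\int_{(-\infty,x]}d\mu$. Let $s>\frac52$ and $f\in C^{[s]+1}(\mathbb{R})$ with $f(0)=0$. Let $u\in C^1([0,T],H^s(\mathbb{R}))$ be the solution of the initial-value problem $$u_t+(\beta\ast f(u))_x=0,\quad x\in\mathbb{R},\ t>0,\qquad u(x,0)=\varphi(x),\quad x\in\mathbb{R},$$ with $\varphi\in H^s(\mathbb{R})$. For $h>0$ and $x_i=ih$, $i\in\mathbb{Z}$, let $\mathbf{u}_h\in C^1([0,T_h),l^\infty)$ be the solution, with maximal existence time $T_h$, of $$\frac{d\mathbf{v}}{dt}=-D\big(\bm{\beta}_h\ast f(\mathbf{v})\big),\qquad \bm{\beta}_h=(\beta(x_i))_{i\in\mathbb{Z}},$$ with initial data $\bm{\varphi}_h=(\varphi(x_i))_{i\in\mathbb{Z}}$. Let $\mathbf{u}(t)=(u(x_i,t))_{i\in\mathbb{Z}}$. Then there is some $h_0>0$ so that for $h\le h_0$ the maximal existence time $T_h$ of $\mathbf{u}_h$ is at least $T$ and $$\|\mathbf{u}(t)-\mathbf{u}_h(t)\|_{l^\infty}=\mathcal{O}(h)$$ for all $t\in[0,T]$.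
   Context: All functions are real-valued. $(\beta\ast v)(x)=\int_{\mathbb{R}}\beta(x-y)v(y)\,dy$ for functions; $\mu$ is a signed measure and $\beta'$ is the distributional derivative. $H^s(\mathbb{R})$ is the usual $L^2$-based Sobolev space of index $s$ on $\mathbb{R}$ (elements are identified with their continuous representatives), and $[s]$ is the largest integer less than or equal to $s$. $l^\infty$ is the Banach space of bounded doubly infinite real sequences $\mathbf{w}=(w_i)_{i\in\mathbb{Z}}$ with the sup-norm. For sequences, $(\mathbf{w}\ast\mathbf{v})_i=\sum_{j\in\mathbb{Z}}h\,w_{i-j}v_j$, $(D\mathbf{w})_i=\frac{1}{2h}(w_{i+1}-w_{i-1})$, and $f(\mathbf{v})=(f(v_i))_{i\in\mathbb{Z}}$. The constant implied by $\mathcal{O}(h)$ is independent of $h\in(0,h_0]$ and of $t\in[0,T]$. *)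

(* Defs.v *)
From HB Require Import structures.
From mathcomp Require Import all_boot all_order all_algebra.
From mathcomp Require Import all_classical all_reals all_analysis.

Set Implicit Arguments.
Unset Strict Implicit.
Unset Printing Implicit Defensive.

Import Order.TTheory GRing.Theory Num.Theory.
Import numFieldNormedType.Exports.

Local Open Scope classical_set_scope.
Local Open Scope ring_scope.

Section FunctionSpaces.
Variable R : realType.

Definition class_C (k : nat) (f : R -> R) : Prop :=
  (forall j, (j < k)%N -> forall x, derivable f^`(j)%classic x 1) /\ continuous f^`(k)%classic.

Definition test_function (phi : R -> R) : Prop :=
  (forall k, class_C k phi) /\ (exists M, forall x, M < `|x| -> phi x = 0).

(* The integral against the signed measure mu is the difference of the
   integrals against the two parts of its Jordan decomposition, which do not
   depend on the Hahn decomposition (P, N). *)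
Definition distributional_derivative (beta : R -> R)
    (mu : {charge set (measurableTypeR R) -> \bar R}) : Prop :=
  forall (P N : set (measurableTypeR R)) (muPN : hahn_decomposition mu P N) (phi : R -> R),
    test_function phi ->
    \int[lebesgue_measure]_x (beta x * phi^`()%classic x) =
    - (\int[jordan_pos muPN]_x phi x - \int[jordan_neg muPN]_x phi x).

Definition convolution (beta v : R -> R) (x : R) : R :=
  \int[lebesgue_measure]_y (beta (x - y) * v y).

(* Real and imaginary parts of the integral over [-n, n] of
   v(x) e^(- i x xi) dx. *)
Definition truncated_fourier_re (v : R -> R) (n : nat) (xi : R) : R :=
  \int[lebesgue_measure]_(x in `[- n%:R, n%:R]) (v x * cos (x * xi)).

Definition truncated_fourier_im (v : R -> R) (n : nat) (xi : R) : R :=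
  - \int[lebesgue_measure]_(x in `[- n%:R, n%:R]) (v x * sin (x * xi)).

(* a + i b is the Fourier-Plancherel transform of v. *)
Definition is_fourier_transform (v a b : R -> R) : Prop :=
  [/\ v \in Lfun lebesgue_measure 2%:E,
      a \in Lfun lebesgue_measure 2%:E,
      b \in Lfun lebesgue_measure 2%:E,
      'N[lebesgue_measure]_2%:E[EFin \o (truncated_fourier_re v n \- a)%R]%E
        @[n --> \oo] --> 0%E
    & 'N[lebesgue_measure]_2%:E[EFin \o (truncated_fourier_im v n \- b)%R]%E
        @[n --> \oo] --> 0%E].

(* The transform exists for every v in L^2 and is unique almost everywhere, so
   the infimum below ranges over exactly one value; it ranges over none, and
   the norm is +oo, when v is not in L^2. *)
Definition sobolev_norm (s : R) (v : R -> R) : \bar R :=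
  ereal_inf [set r | exists a b : R -> R, is_fourier_transform v a b /\
    r = sqrte (\int[lebesgue_measure]_xi
                 ((1 + xi ^+ 2) `^ s * (a xi ^+ 2 + b xi ^+ 2))%:E)%E].

(* Elements are continuous representatives, so this is all of H^s only when
   s > 1/2. *)
Definition sobolev (s : R) : set (R -> R) :=
  [set v | continuous v /\ (sobolev_norm s v < +oo)%E].

Definition linf_norm (w : int -> R) : \bar R :=
  ereal_sup (range (fun i => `|w i|%:E)).

Definition linf : set (int -> R) := [set w | (linf_norm w < +oo)%E].

(* v is in C^1(I, E) with derivative v', where E is a space of functions on X
   normed by N; derivatives at endpoints of I are one-sided. *)
Definition C1_curve (X : Type) (E : set (X -> R)) (N : (X -> R) -> \bar R)
    (I : set R) (v v' : R -> X -> R) : Prop :=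
  forall t, I t ->
    [/\ E (v t), E (v' t),
        (fun r => N (fun x => (v r x - v t x) / (r - t) - v' t x))
          @ within I t^' --> 0%E
      & (fun r => N (fun x => v' r x - v' t x)) @ within I (nbhs t) --> 0%E].

End FunctionSpaces.

Section Problems.
Variable R : realType.

Definition is_solution (s T : R) (beta f phi : R -> R) (u : R -> R -> R) :
    Prop :=
  exists ut : R -> R -> R,
    [/\ C1_curve (sobolev s) (sobolev_norm s) `[0, T] u ut,
        forall t x, 0 < t <= T ->
          derivable (convolution beta (f \o u t)) x 1 /\
          ut t x + (convolution beta (f \o u t))^`()%classic x = 0
      & forall x, u 0 x = phi x].

Definition grid (h : R) (v : R -> R) : int -> R := fun i => v (i%:~R * h).

(* Negz n is - (n + 1). *)
Definition zseries (a : int -> R) : R :=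
  limn (series (fun n : nat => a (Posz n))) +
  limn (series (fun n : nat => a (Negz n))).

Definition discrete_convolution (h : R) (w v : int -> R) : int -> R :=
  fun i => zseries (fun j => h * w (i - j) * v j).

Definition centered_difference (h : R) (w : int -> R) : int -> R :=
  fun i => (w (i + 1) - w (i - 1)) / (2 * h).

Definition semidiscrete_rhs (beta f : R -> R) (h : R) (v : int -> R) :
    int -> R :=
  fun i => - centered_difference h
               (discrete_convolution h (grid h beta) (f \o v)) i.

Definition is_semidiscrete_solution (beta f phi : R -> R) (h : R)
    (tau : \bar R) (v : R -> int -> R) : Prop :=
  v 0 =1 grid h phi /\
  C1_curve (@linf R) (@linf_norm R) [set t | 0 <= t /\ (t%:E < tau)%E]
    v (fun t => semidiscrete_rhs beta f h (v t)).

Definition is_maximal_semidiscrete_solution (beta f phi : R -> R) (h : R)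
    (tau : \bar R) (v : R -> int -> R) : Prop :=
  [/\ (0 < tau)%E, is_semidiscrete_solution beta f phi h tau v
    & forall (tau' : \bar R) (w : R -> int -> R), (tau < tau')%E ->
        is_semidiscrete_solution beta f phi h tau' w ->
        ~ (forall t, 0 <= t -> (t%:E < tau)%E -> w t =1 v t)].

End Problems.

(* Main.v *)
Require Import Defs.
From HB Require Import structures.
From mathcomp Require Import all_boot all_order all_algebra.
From mathcomp Require Import all_classical all_reals all_analysis.
From mathcomp Require Import measurable_realfun.
From mathcomp Require Import zify ring lra.

Set Implicit Arguments.
Unset Strict Implicit.
Unset Printing Implicit Defensive.

Import Order.TTheory GRing.Theory Num.Theory.
Import numFieldNormedType.Exports.

Local Open Scope classical_set_scope.
Local Open Scope ring_scope.

(** The scheme converges because the operator on the right of the equation and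
    its discretization are both convolutions with a finite measure, hence
    bounded in the sup norm by the mass B of that measure, whatever h is.  Let
    F1 and F2 be the distribution functions of the positive and the negative
    part of mu, so that beta = F1 - F2.

    Consistency.  For a bounded L-Lipschitz function g, the derivative of the
    convolution of beta and g at x is the integral of g(x - w) dmu(w)
    (increment_estimate, convolution_derivative), and the centered difference
    of the discrete convolution at x_i is the mean of two Riemann sums for the
    same integral, over cells of length h.  They differ by at most L h B
    (riemann_sum_estimate, truncation_error).

    Stability.  The semidiscrete right-hand side is Lipschitz in the sup norm,
    with constant B times that of f (semidiscrete_rhs_lipschitz).  With the
    consistency estimate for g = f(u(t)), Gronwall's inequality bounds the
    error by a multiple of h (gronwall, semidiscrete_error).

    Regularity of u.  The argument needs u(t) bounded and Lipschitz uniformly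
    in t (sobolev_curve_bounds).  By compactness of [0, T] this follows from
    the embedding of H^s into the bounded Lipschitz functions
    (sobolev_embedding), which is proved from the definition of the Fourier
    transform in L^2 by Abel summation: the Poisson kernel e / (e^2 + z^2) is
    the cosine transform of a decaying exponential (laplace_cos), so smoothing
    v with this kernel amounts to damping its transform (poisson_integral).
    As e tends to 0 the smoothed function tends to pi v (poisson_limit), while
    the damped transform is integrable, even after multiplication by |xi|,
    with a bound given by the Sobolev norm (fourier_pairing_bound).

    Existence up to time T.  If f is composed with the projection onto
    [-(M + 1), M + 1], where M bounds |u|, the semidiscrete right-hand side is
    bounded and globally Lipschitz, and Picard iteration yields a solution p
    for all times (clipped_solution).  The error estimate applies to p and
    keeps it below M + 1/2 on [0, T] if h is small; hence p stays in the
    region where the projection changes nothing until some time after T.  So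
    p solves the original problem beyond T; by uniqueness it agrees with u_h,
    and by maximality T_h is greater than T. *)

(** * Differentiation uniformly in a parameter *)
Section UniformDerivative.
Variable R : realType.

(** Differentiability on J for the sup norm over X, in a form that applies to
    unbounded values; at an end point of J the derivative is one-sided. *)
Definition uniform_derivative (X : Type) (J : set R) (v v' : R -> X -> R) :=
  forall t, J t -> forall eps : R, 0 < eps -> exists2 d : R, 0 < d &
    forall r, J r -> `|r - t| < d -> forall x,
      `|v r x - v t x - (r - t) * v' t x| <= eps * `|r - t|.

Lemma uniform_derivativeB (X : Type) (J : set R) (v v' w w' : R -> X -> R) :
  uniform_derivative J v v' -> uniform_derivative J w w' ->
  uniform_derivative J (fun t x => v t x - w t x) (fun t x => v' t x - w' t x).
Proof.
move=> hv hw t Jt e e0.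
have [d1 d10 h1] := hv t Jt (e / 2) ltac:(by rewrite divr_gt0).
have [d2 d20 h2] := hw t Jt (e / 2) ltac:(by rewrite divr_gt0).
exists (Num.min d1 d2); first by rewrite lt_min d10.
move=> r Jr; rewrite lt_min => /andP[rd1 rd2] x.
have -> : v r x - w r x - (v t x - w t x) - (r - t) * (v' t x - w' t x) =
  (v r x - v t x - (r - t) * v' t x) - (w r x - w t x - (r - t) * w' t x).
  by ring.
rewrite (le_trans (ler_normB _ _))//.
have := h1 r Jr rd1 x; have := h2 r Jr rd2 x; lra.
Qed.

Lemma uniform_derivativeS (X : Type) (J J' : set R) (v v' : R -> X -> R) :
  J' `<=` J -> uniform_derivative J v v' -> uniform_derivative J' v v'.
Proof.
move=> JJ hv t /JJ Jt e e0; have [d d0 h] := hv t Jt e e0.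
by exists d => // r /JJ; exact: h.
Qed.

Lemma uniform_derivative_comp (X Y : Type) (g : Y -> X) (J : set R)
    (v v' : R -> X -> R) :
  uniform_derivative J v v' ->
  uniform_derivative J (fun t y => v t (g y)) (fun t y => v' t (g y)).
Proof.
move=> hv t Jt e e0; have [d d0 h] := hv t Jt e e0.
by exists d => // r Jr rd y; exact: h.
Qed.

(** Near a given time the values move by a bounded amount, so that compactness
    of the interval turns bounds at single times into one bound. *)
Lemma uniform_derivative_bounded (X : Type) (a b : R) (v v' : R -> X -> R) :
  uniform_derivative `[a, b] v v' ->
  (forall t, t \in `[a, b] -> exists M : R, forall x, `|v t x| <= M) ->
  (forall t, t \in `[a, b] -> exists M : R, forall x, `|v' t x| <= M) ->
  exists M : R, forall t, t \in `[a, b] -> forall x, `|v t x| <= M.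
Proof.
move=> hv bv bv'.
have /compact_near_coveringP/near_covering_withinP cvr := @segment_compact R a b.
have [|M [_ /(_ (M + 1))]] := cvr R (+oo) (fun M t => forall x, `|v t x| <= M) _.
  move=> t tab.
  have [M1 hM1] := bv t tab; have [M2 hM2] := bv' t tab.
  have [d d0 h] := hv t tab 1 ltr01.
  near=> r M => /= rab x.
  have rd : `|r - t| < d.
    by rewrite distrC; near: r; exact: nbhsx_ballx.
  have r1 : `|r - t| < 1.
    by rewrite distrC; near: r; exact: nbhsx_ballx.
  have := h r rab rd x; have := hM1 x; have := hM2 x => h2 h1 h0.
  have -> : v r x = (v r x - v t x - (r - t) * v' t x) + v t x + (r - t) * v' t x.
    by ring.
  have M2r : `|(r - t) * v' t x| <= M2.
    rewrite normrM (le_trans _ h2)// ler_piMl// ltW//.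
  apply: (@le_trans _ _ (1 + M1 + M2)).
    rewrite (le_trans (ler_normD _ _))// lerD//.
    rewrite (le_trans (ler_normD _ _))// lerD//.
    by rewrite (le_trans h0)// mul1r ltW.
  near: M; apply: nbhs_pinfty_ge; exact: num_real.
rewrite ltrDl ltr01 => /(_ isT) h.
by exists (M + 1) => t tab x; exact: h.
Unshelve. all: by end_near. Qed.

Lemma uniform_derivative_is_derive (X : Type) (a b : R) (v v' : R -> X -> R) x t :
  uniform_derivative `[a, b] v v' -> t \in `]a, b[ ->
  is_derive t 1 (v^~ x) (v' t x).
Proof.
move=> hv; rewrite in_itv/= => /andP[ta tb].
have hc : (fun h => h^-1 *: ((v^~ x) (h *: 1 + t) - (v^~ x) t)) @ 0^' --> v' t x.
  apply/cvgrPdist_le => e e0.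
  have [|d d0 h] := hv t _ e e0; first by rewrite /= in_itv/= !ltW.
  near=> k.
  have k0 : k != 0 by near: k; exact: nbhs_dnbhs_neq.
  have kd : `|k| < d by near: k; apply: dnbhs0_lt.
  have ka : `|k| < t - a by near: k; apply: dnbhs0_lt; rewrite subr_gt0.
  have kb : `|k| < b - t by near: k; apply: dnbhs0_lt; rewrite subr_gt0.
  have := h (k *: 1 + t); rewrite /= /GRing.scale/= mulr1 addrK.
  move=> /(_ _ kd x) hh.
  have {hh} : `|v (k + t) x - v t x - k * v' t x| <= e * `|k|.
    apply: hh; rewrite in_itv/=.
    move: ka kb; rewrite !ltr_norml => /andP[? ?] /andP[? ?].
    by apply/andP; split; lra.
  move=> hh; rewrite distrC.
  have -> : k^-1 * (v (k + t) x - v t x) - v' t x =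
     k^-1 * (v (k + t) x - v t x - k * v' t x) by field.
  by rewrite normrM normfV mulrC ler_pdivrMr ?normr_gt0.
have dv : derivable (v^~ x) t 1 by apply/cvg_ex; exists (v' t x).
by split => //; apply/cvg_lim.
Unshelve. all: by end_near. Qed.

Lemma uniform_derivative_continuous (X : Type) (a b : R) (v v' : R -> X -> R) x :
  uniform_derivative `[a, b] v v' -> {within `[a, b], continuous (v^~ x)}.
Proof.
move=> hv; apply/subspace_continuousP => t tab; apply/cvgrPdist_lt => e e0.
have [d d0 h] := hv t tab 1 ltr01.
have K0 : 0 < `|v' t x| + 1 by rewrite ltr_wpDl.
near=> r.
have rab : `[a, b]%classic r by near: r; exact: withinT.
have rd : `|r - t| < d.
  by rewrite distrC; near: r; apply: cvg_within; exact: nbhsx_ballx.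
have re : `|r - t| < e / (`|v' t x| + 1).
  rewrite distrC; near: r; apply: cvg_within; apply: nbhsx_ballx.
  exact: divr_gt0.
have := h r rab rd x; rewrite mul1r => hh.
rewrite distrC.
have -> : v r x - v t x = (v r x - v t x - (r - t) * v' t x) + (r - t) * v' t x.
  by ring.
rewrite (le_lt_trans (ler_normD _ _))// (le_lt_trans (lerD hh (lexx _)))//.
by move: re; rewrite normrM ltr_pdivlMr//; lra.
Unshelve. all: by end_near. Qed.

End UniformDerivative.

(** * Gronwall's inequality and Picard iteration in the sup norm *)
Section Gronwall.
Variable R : realType.

Lemma mean_value_bound (a c : R) (e e' b b' : R -> R) : a <= c ->
  (forall t, t \in `]a, c[ -> is_derive t 1 e (e' t)) ->
  (forall t, t \in `]a, c[ -> is_derive t 1 b (b' t)) ->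
  {within `[a, c], continuous e} -> {within `[a, c], continuous b} ->
  (forall t, t \in `]a, c[ -> `|e' t| <= b' t) ->
  `|e c - e a| <= b c - b a.
Proof.
rewrite le_eqVlt => /predU1P[<-|ac]; first by rewrite !subrr normr0.
move=> de db ce cb h.
have [|t|t1 t1ac E1] := @MVT R (b \- e) (b' \- e') a c ac.
- by move=> t tac; apply: is_deriveB; [exact: db|exact: de].
- by apply: continuousB; [exact: cb|exact: ce].
have [|t|t2 t2ac E2] := @MVT R (b \+ e) (b' \+ e') a c ac.
- by move=> t tac; apply: is_deriveD; [exact: db|exact: de].
- by apply: continuousD; [exact: cb|exact: ce].
have ac0 : 0 <= c - a by rewrite subr_ge0 ltW.
have := h _ t1ac; have := h _ t2ac; rewrite !ler_norml.
move=> /andP[h1 _] /andP[_ h2].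
have : 0 <= (b' \- e') t1 * (c - a) by rewrite mulr_ge0//=; lra.
have : 0 <= (b' \+ e') t2 * (c - a) by rewrite mulr_ge0//=; lra.
rewrite -E1 -E2 /=; lra.
Qed.

Lemma is_derive_expM (k t : R) : is_derive t 1 (fun t => expR (k * t)) (k * expR (k * t)).
Proof.
have d1 : is_derive t 1 (fun t => k * t) k.
  by apply: is_derive_eq; rewrite /GRing.scale/= !mulr1.
have := @is_derive1_comp R expR (fun t => k * t) t _ _ (is_derive_expR _) d1.
by rewrite mulrC.
Qed.

(** The supremum over x need not be differentiable, so the argument compares
    with multiples of exp(2 Lam t).  If A exp(2 Lam t) dominates all |e_x|, then
    so does (delta tau + A / 2) exp(2 Lam t): thanks to the factor 2 in the
    exponent, the integral of Lam A exp(2 Lam s) is at most half of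
    A exp(2 Lam t).  The infimum of the admissible A is therefore at most
    2 delta tau. *)
Lemma gronwall (X : Type) (tau delta Lam : R) (e e' : R -> X -> R) :
  0 <= tau -> 0 <= delta -> 0 < Lam ->
  uniform_derivative `[0, tau] e e' ->
  (forall x, e 0 x = 0) ->
  (exists M : R, forall t : R, t \in `[0, tau] -> forall x, `|e t x| <= M) ->
  (forall t S : R, 0 < t < tau -> (forall x, `|e t x| <= S) ->
     forall x, `|e' t x| <= delta + Lam * S) ->
  forall t : R, t \in `[0, tau] -> forall x,
    `|e t x| <= 2 * delta * tau * expR (2 * Lam * tau).
Proof.
move=> tau0 delta0 Lam0 de e0 [M hM] he.
have Lam20 : 0 <= 2 * Lam by rewrite mulr_ge0// ltW.
pose good (A : R) := 0 <= A /\ forall t : R, t \in `[0, tau] -> forall x,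
  `|e t x| <= A * expR (2 * Lam * t).
have expge1 (t : R) : 0 <= t -> 1 <= expR (2 * Lam * t).
  by move=> t0; rewrite -[leLHS]expR0 ler_expR mulr_ge0.
have good0 : good `|M|.
  split => // t tt x; rewrite (le_trans (hM _ tt x))// (le_trans (ler_norm _))//.
  move: tt; rewrite in_itv/= => /andP[tt _].
  exact: ler_peMr (normr_ge0 _) (expge1 _ tt).
have step (A : R) : good A -> good (delta * tau + A / 2).
  move=> [A0 hA]; split; first by rewrite addr_ge0 ?mulr_ge0// divr_ge0.
  move=> t tt x; have := tt; rewrite in_itv/= => /andP[t0 ttau].
  pose b (t : R) := delta * t + A / 2 * expR (2 * Lam * t).
  pose b' (t : R) := delta + A / 2 * (2 * Lam * expR (2 * Lam * t)).
  have db (s : R) : is_derive s 1 b (b' s).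
    have d1 := is_derive_expM (2 * Lam) s.
    have d2 : is_derive s 1 (fun t => delta * t) delta.
      by apply: is_derive_eq; rewrite /GRing.scale/= !mulr1.
    exact: (is_deriveD d2 (@is_deriveZ R R^o R^o _ (A / 2) s 1 _ d1)).
  have sub : `[0, t]%classic `<=` `[0, tau]%classic.
    by apply: subset_itvl; rewrite bnd_simp.
  have det := uniform_derivativeS sub de.
  have H : `|e t x| <= b t - b 0.
    rewrite -[e t x]subr0 -[in X in _ - X](e0 x).
    apply: (@mean_value_bound 0 t (e^~ x) (e'^~ x) b b') => //.
    - by move=> s st; exact: uniform_derivative_is_derive det st.
    - exact: uniform_derivative_continuous det.
    - apply: derivable_within_continuous => s _.
      by have [] := db s.
    - move=> s; rewrite in_itv/= => /andP[s0 st].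
      have ss : s \in `[0, tau].
        by rewrite in_itv/= ltW//= (le_trans (ltW st)).
      have s01 : 0 < s < tau by rewrite s0 (lt_le_trans st).
      apply: le_trans (he s _ s01 (hA s ss) x) _.
      rewrite /b'; set E := expR _; nra.
  apply: le_trans H _; rewrite /b mulr0 add0r mulr0 expR0.
  have E1 := expge1 _ t0; move: E1; set E := expR _ => E1.
  have : delta * t <= delta * tau by rewrite ler_wpM2l.
  have : 0 <= delta * tau * (E - 1) by rewrite !mulr_ge0// subr_ge0.
  by have := A0; lra.
have hinf : has_inf good.
  by split; [exists (Num.norm M)|exists 0 => A []].
have infE : inf good <= 2 * delta * tau.
  have : 2 * (inf good - delta * tau) <= inf good.
    apply: lb_le_inf; first by exists `|M|.
    move=> A /step gA; have := @ge_inf R good hinf.2 _ gA; lra.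
  lra.
move=> t tt x; have := tt; rewrite in_itv/= => /andP[t0 ttau].
have : `|e t x| / expR (2 * Lam * t) <= inf good.
  apply: lb_le_inf; first by exists `|M|.
  by move=> A [A0 hA]; rewrite ler_pdivrMr ?expR_gt0// hA.
rewrite ler_pdivrMr ?expR_gt0// => /le_trans; apply.
rewrite ler_pM ?expR_ge0//.
  by apply: lb_le_inf; [exists (Num.norm M)|move=> A []].
by rewrite ler_expR ler_wpM2l.
Qed.

End Gronwall.

Section Picard.
Variable R : realType.

(** The base point -1 makes 0 an interior point, so that the derivative at
    time 0 exists in the two-sided sense. *)
Definition antiderivative (c : R -> R) (t : R) : R :=
  \int[lebesgue_measure]_(s in `[-1, t]) c s - \int[lebesgue_measure]_(s in `[-1, 0]) c s.

Lemma is_derive_antiderivative (c : R -> R) : continuous c ->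
  forall t : R, 0 <= t -> is_derive t 1 (antiderivative c) (c t).
Proof.
move=> cc t t0.
have t1 : t < t + 1 by rewrite ltrDl.
have ic : lebesgue_measure.-integrable `[-1, t + 1] (EFin \o c).
  apply: continuous_compact_integrable; first exact: segment_compact.
  exact: continuous_subspaceT.
have t1' : -1 < t by rewrite (lt_le_trans _ t0)// ltrN10.
have [d1 d2] := continuous_FTC1_closed t1 ic t1' (cc t).
pose k := \int[lebesgue_measure]_(s in `[-1, 0]) c s.
have dk : is_derive t 1 (fun=> k) 0 by exact: is_derive_cst.
have dG : is_derive t 1 (fun x : R => \int[lebesgue_measure]_(s in `[-1, x]) c s) (c t).
  by apply: DeriveDef; [exact: d1|rewrite -derive1E; exact: d2].
have := is_deriveB dG dk; rewrite subr0; exact.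
Qed.

Lemma le_of_geometric_error (x y Q : R) : (forall n : nat, x <= y + Q * 2^-1 ^+ n) -> x <= y.
Proof.
move=> h; have cv : (fun n : nat => y + Q * 2^-1 ^+ n) @ \oo --> y.
  rewrite -[X in _ --> X]addr0 -[X in _ --> _ + X](mulr0 Q).
  apply: cvgD; first exact: cvg_cst.
  apply: cvgM; first exact: cvg_cst.
  by apply: cvg_expr; rewrite ger0_norm// invf_lt1// ltr1n.
rewrite -(cvg_lim _ cv)//; apply: limr_ge; first by apply/cvg_ex; exists y.
by near=> n; exact: h.
Unshelve. all: by end_near. Qed.

Variables (I : Type) (Phi : (I -> R) -> I -> R) (Lam M0 : R) (phi : I -> R).
Hypothesis Lam0 : 0 < Lam.
Hypothesis PhiL : forall (x y : I -> R) (K : R), (forall i, `|x i - y i| <= K) ->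
  forall i, `|Phi x i - Phi y i| <= Lam * K.
Hypothesis PhiM : forall (x : I -> R) i, `|Phi x i| <= M0.

(** The integrand is frozen at its value at 0 for negative times, where the
    iterates are not controlled. *)
Fixpoint picard_iterate (n : nat) : R -> I -> R :=
  if n is n'.+1 then
    fun t i => phi i + antiderivative (fun s => Phi (picard_iterate n' (Num.max s 0)) i) t
  else fun=> phi.

Local Notation p := picard_iterate.

Let time_lipschitz n := forall t r : R, 0 <= t -> 0 <= r ->
  forall i, `|p n t i - p n r i| <= M0 * `|t - r|.

Let PhiC n : time_lipschitz n -> forall i, continuous (fun s : R => Phi (p n (Num.max s 0)) i).
Proof.
move=> hn i s; apply/cvgrPdist_lt => e e0.
have M00 : 0 <= M0 by exact: le_trans (normr_ge0 _) (PhiM phi i).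
have K0 : 0 < Lam * M0 + 1 by rewrite ltr_wpDl// mulr_ge0// ltW.
near=> r.
have rs : `|s - r| < e / (Lam * M0 + 1).
  by near: r; apply: (@nbhsx_ballx _ R s (e / (Lam * M0 + 1))); exact: divr_gt0.
have mm : `|Num.max s 0 - Num.max r 0| <= `|s - r|.
  by rewrite /Num.max; case: ltP => ?; case: ltP => ?;
   rewrite ?subrr ?normr0 ?normr_ge0// ler_norml;
   have := ler_norm (s - r); have := ler_norm (r - s); rewrite (distrC r s); lra.
have := PhiL (hn (Num.max s 0) (Num.max r 0) _ _) i.
move=> H; apply: (le_lt_trans (PhiL (K := M0 * `|s - r|) _ i)).
  move=> j; apply: le_trans (hn _ _ _ _ j) _; rewrite ?le_max ?lexx ?orbT//.
  by rewrite ler_wpM2l.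
move: rs; rewrite ltr_pdivlMr// mulrA.
by have := normr_ge0 (s - r); lra.
Unshelve. all: by end_near. Qed.

Let dp_of n : time_lipschitz n -> forall (t : R) i, 0 <= t ->
  is_derive t 1 ((p n.+1)^~ i) (Phi (p n t) i).
Proof.
move=> hn t i t0.
have := is_derive_antiderivative (@PhiC n hn i) t0.
rewrite (max_idPl t0) => d1.
have d0 : is_derive t 1 (fun=> phi i : R) 0 by exact: is_derive_cst.
by have := is_deriveD d0 d1; rewrite add0r; exact.
Qed.

Let mvt_p n : time_lipschitz n -> forall (t r : R) i, 0 <= t -> t <= r ->
  exists2 c, t <= c <= r & p n.+1 r i - p n.+1 t i = Phi (p n c) i * (r - t).
Proof.
move=> hn t r i t0 tr.
have [s||c ctr E] := @MVT_segment R ((p n.+1)^~ i) (fun s => Phi (p n s) i) t r tr.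
- rewrite in_itv/= => /andP[ts _]; apply: dp_of => //.
  exact: le_trans t0 (ltW ts).
- apply: derivable_within_continuous => s; rewrite in_itv/= => /andP[ts _].
  by have [] := dp_of hn i (le_trans t0 ts).
- by exists c => //; move: ctr; rewrite in_itv.
Qed.

Let lip n : time_lipschitz n.
Proof.
elim: n => [|n IH] t r t0 r0 i.
  rewrite /= subrr normr0 mulr_ge0//.
  by exact: le_trans (normr_ge0 _) (PhiM phi i).
wlog tr : t r t0 r0 / r <= t.
  move=> H; have [/H->//|/ltW tr] := leP r t.
  by rewrite distrC (distrC t) H.
have [c _ ->] := mvt_p IH i r0 tr.
by rewrite normrM ler_wpM2r.
Qed.

Let dp n (t : R) i : 0 <= t -> is_derive t 1 ((p n.+1)^~ i) (Phi (p n t) i).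
Proof. exact: dp_of. Qed.

Let p0 n i : p n 0 i = phi i.
Proof. by case: n => //= n; rewrite /antiderivative subrr addr0. Qed.

Let quad n (t r : R) i : 0 <= t -> 0 <= r ->
  `|p n.+1 r i - p n.+1 t i - (r - t) * Phi (p n t) i| <= Lam * M0 * (r - t) ^+ 2.
Proof.
move=> t0 r0.
have M00 : 0 <= M0 by exact: le_trans (normr_ge0 _) (PhiM phi i).
have H (c : R) : 0 <= c -> `|c - t| <= `|r - t| ->
    p n.+1 r i - p n.+1 t i = Phi (p n c) i * (r - t) ->
    `|p n.+1 r i - p n.+1 t i - (r - t) * Phi (p n t) i| <= Lam * M0 * (r - t) ^+ 2.
  move=> c0 ct ->.
  rewrite mulrC -mulrBr normrM -real_normK ?num_real// expr2.
  rewrite [leRHS]mulrC -!mulrA ler_wpM2l//.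
  have := PhiL (@lip n c t c0 t0) i => /le_trans; apply.
  have := ler_wpM2l (mulr_ge0 (ltW Lam0) M00) ct; lra.
have [tr|/ltW rt] := leP t r.
  have [c /andP[tc cr] E] := mvt_p (@lip n) i t0 tr.
  apply: H E; first exact: le_trans tc.
  by rewrite !ger0_norm ?subr_ge0// lerD2r.
have [c /andP[rc ct] E] := mvt_p (@lip n) i r0 rt.
apply: (H c); first exact: le_trans rc.
  by rewrite !ler0_norm ?subr_le0// lerN2 lerD2r.
by rewrite -opprB E -mulrN opprB.
Qed.

Let E (t : R) := expR (2 * Lam * t).

(** Against the weight exp(2 Lam t) one integration gains a factor 1/2, so the
    iterates converge on the whole half line at once. *)
Let iterates_close n (t : R) i : 0 <= t ->
  `|p n.+1 t i - p n t i| <= M0 / (2 * Lam) * 2^-1 ^+ n * E t.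
Proof.
have M00 : 0 <= M0 by exact: le_trans (normr_ge0 _) (PhiM phi i).
have L20 : 0 < 2 * Lam by rewrite mulr_gt0.
elim: n t i => [|n IH] t i t0.
  rewrite expr0 mulr1; have := @lip 1 t 0 t0 (lexx _) i; rewrite p0 subr0.
  move/le_trans; apply; rewrite -mulrA ler_wpM2l// ger0_norm//.
  rewrite ler_pdivlMl//.
  by have := expR_ge1Dx (2 * Lam * t); rewrite /E; lra.
pose c := M0 / (2 * Lam) * 2^-1 ^+ n.+1.
have db (s : R) : is_derive s 1 (c \*: E) (c * (2 * Lam * E s)).
  exact: (@is_deriveZ R R^o R^o _ c s 1 _ (is_derive_expM (2 * Lam) s)).
have := @mean_value_bound R 0 t (fun t => p n.+2 t i - p n.+1 t i)
  (fun t => Phi (p n.+1 t) i - Phi (p n t) i) (c \*: E)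
  (fun t => c * (2 * Lam * E t)) t0 _ _ _ _ _.
rewrite !p0 subrr subr0 => H.
have c0 : 0 <= c by rewrite /c !mulr_ge0// ?invr_ge0 ?exprn_ge0// ltW.
have {}H : `|p n.+2 t i - p n.+1 t i| <= (c \*: E) t - (c \*: E) 0.
  apply: H => //.
  - move=> s; rewrite in_itv/= => /andP[/ltW s0 _].
    exact: (is_deriveB (dp n.+1 i s0) (dp n i s0)).
  - apply: derivable_within_continuous => s; rewrite in_itv/= => /andP[s0 _].
    by have [] := is_deriveB (dp n.+1 i s0) (dp n i s0).
  - by apply: derivable_within_continuous => s _; have [] := db s.
  - move=> s; rewrite in_itv/= => /andP[/ltW s0 _].
    apply: le_trans (PhiL (fun j => IH s j s0) i) _.
    rewrite /c exprSr; set q := 2^-1 ^+ n.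
    suff -> : Lam * (M0 / (2 * Lam) * q * E s) =
      M0 / (2 * Lam) * (q * 2^-1) * (2 * Lam * E s) by [].
    by field; rewrite gt_eqF.
apply: le_trans H _; rewrite /GRing.scale/=.
by rewrite gerBl mulr_ge0// expR_ge0.
Qed.

(** The second-order estimate holds for each iterate by the mean value theorem
    and passes to the limit.  It expresses differentiability of the limit,
    uniformly in i, and spares an exchange of limit and derivative. *)
Lemma picard_existence : exists p : R -> I -> R, p 0 = phi /\
  forall t r : R, 0 <= t -> 0 <= r -> forall i,
    `|p r i - p t i - (r - t) * Phi (p t) i| <= Lam * M0 * (r - t) ^+ 2.
Proof.
pose C := (M0 / (2 * Lam)) * 2.
have CE (i : I) (t : R) : 0 <= t -> forall n : nat,
    `|p n.+1 t i - p n t i| <= C * E t * (2^-1 ^+ n - 2^-1 ^+ n.+1).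
  move=> t0 n; apply: le_trans (iterates_close n i t0) _.
  by rewrite /C exprS; set q := _ ^+ n; lra.
pose lo (t : R) (i : I) (n : nat) := p n t i - C * E t * 2^-1 ^+ n.
pose hi (t : R) (i : I) (n : nat) := p n t i + C * E t * 2^-1 ^+ n.
have lohi (t : R) (i : I) : 0 <= t -> forall m n, lo t i m <= hi t i n.
  move=> t0.
  have CE0 : 0 <= C * E t.
    have M00 : 0 <= M0 by exact: le_trans (normr_ge0 _) (PhiM phi i).
    by rewrite /C !mulr_ge0 ?expR_ge0 ?invr_ge0 ?mulr_ge0// ltW.
  have loS n : lo t i n <= lo t i n.+1.
    by have := CE i t t0 n; rewrite ler_norml /lo => /andP[]; lra.
  have hiS n : hi t i n.+1 <= hi t i n.
    by have := CE i t t0 n; rewrite ler_norml /hi => /andP[]; lra.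
  have lom m k : lo t i m <= lo t i (k + m)%N.
    by elim: k => // k /le_trans; apply; exact: loS.
  have him m k : hi t i (k + m)%N <= hi t i m.
    by elim: k => // k; apply: le_trans; exact: hiS.
  move=> m n; apply: le_trans (lom m n) _; rewrite addnC.
  apply: le_trans (him n m); rewrite /lo /hi.
  have : 0 <= C * E t * 2^-1 ^+ (m + n) by rewrite mulr_ge0// exprn_ge0// invr_ge0.
  by lra.
pose q (t : R) (i : I) := sup (range (lo t i)).
have qE (t : R) (i : I) (n : nat) : 0 <= t -> `|p n t i - q t i| <= C * E t * 2^-1 ^+ n.
  move=> t0.
  have h1 : lo t i n <= q t i.
    apply: ub_le_sup; last by exists n.
    by exists (hi t i 0%N) => _ [m _ <-]; exact: lohi.
  have h2 : q t i <= hi t i n.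
    apply: ge_sup; first by exists (lo t i 0%N); exists 0%N.
    by move=> _ [m _ <-]; exact: lohi.
  by rewrite ler_norml; move: h1 h2; rewrite /lo /hi; lra.
exists q; split.
  apply/funext => i; apply/eqP; rewrite -subr_eq0 -normr_le0 distrC.
  apply: (@le_of_geometric_error _ _ (C * E 0)) => n.
  by rewrite add0r -(p0 n i) qE.
move=> t r t0 r0 i.
apply: (@le_of_geometric_error _ _ (C * E r + C * E t + `|r - t| * (Lam * (C * E t)))) => n.
have e1 := qE r i n.+1 r0.
have e2 := qE t i n.+1 t0.
have e3 := PhiL (fun j => qE t j n t0) i.
have e4 := quad n i t0 r0.
have -> : q r i - q t i - (r - t) * Phi (q t) i =
   (p n.+1 r i - p n.+1 t i - (r - t) * Phi (p n t) i)
   - (p n.+1 r i - q r i) + (p n.+1 t i - q t i)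
   + (r - t) * (Phi (p n t) i - Phi (q t) i) by ring.
rewrite (le_trans (ler_normD _ _))//.
rewrite (le_trans (lerD (ler_normD _ _) (lexx _)))//.
rewrite (le_trans (lerD (lerD (ler_normB _ _) (lexx _)) (lexx _)))//.
rewrite normrM.
have e5 := ler_wpM2l (normr_ge0 (r - t)) e3.
have e6 (s : R) : C * E s * 2^-1 ^+ n.+1 <= C * E s * 2^-1 ^+ n.
  have M00 : 0 <= M0 by exact: le_trans (normr_ge0 _) (PhiM phi i).
  apply: ler_wpM2l.
    by rewrite /C !mulr_ge0 ?expR_ge0 ?invr_ge0 ?mulr_ge0// ltW.
  rewrite exprS ger_pMl ?exprn_gt0 ?invr_gt0//.
  by rewrite invf_le1// ler1n.
have := e6 r; have := e6 t; lra.
Qed.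

End Picard.

(** * Integrals, Fubini's theorem and reflections of the line *)
Section IntegrationTools.
Context d {T : measurableType d} {R : realType}.
Variable mu : {measure set T -> \bar R}.
Implicit Types (D : set T) (f g : T -> R).

Lemma integrable_dominated D f g : measurable D -> measurable_fun D f ->
  mu.-integrable D (EFin \o g) -> (forall x, D x -> `|f x| <= g x) ->
  mu.-integrable D (EFin \o f).
Proof.
move=> mD mf ig fg; apply: (le_integrable mD _ _ ig) => /=.
  exact/measurable_EFinP.
by move=> x Dx /=; rewrite lee_fin (le_trans (fg _ Dx))// ler_norm.
Qed.

Lemma norm_Rintegral_le D f g : measurable D -> measurable_fun D f ->
  mu.-integrable D (EFin \o g) -> (forall x, D x -> `|f x| <= g x) ->
  `|\int[mu]_(x in D) f x| <= \int[mu]_(x in D) g x.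
Proof.
move=> mD mf ig fg.
have if_ := integrable_dominated mD mf ig fg.
apply: le_trans (le_normr_Rintegral mD if_) _.
apply: le_Rintegral => //; exact: (integrable_norm if_).
Qed.

End IntegrationTools.

Section RealFubini.
Context d1 d2 {T1 : measurableType d1} {T2 : measurableType d2} {R : realType}.
Variables (m1 : {sigma_finite_measure set T1 -> \bar R})
          (m2 : {sigma_finite_measure set T2 -> \bar R}).

Lemma Rintegral_Fubini (f : T1 * T2 -> R) :
  (m1 \x m2)%E.-integrable setT (EFin \o f) ->
  (forall x, m2.-integrable setT (fun y => (f (x, y))%:E)) ->
  (forall y, m1.-integrable setT (fun x => (f (x, y))%:E)) ->
  \int[m1]_x \int[m2]_y f (x, y) = \int[m2]_y \int[m1]_x f (x, y).
Proof.
move=> if_ i2 i1; have := Fubini if_.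
rewrite /fubini_F /fubini_G /= => E; congr fine.
transitivity (\int[m1]_x \int[m2]_y (f (x, y))%:E)%E.
  by apply: eq_integral => x _; rewrite fineK//; exact: integrable_fin_num.
rewrite E; apply: eq_integral => y _.
by rewrite fineK//; exact: integrable_fin_num.
Qed.

Lemma measurable_Rintegral_param (f : T1 * T2 -> R) :
  (m1 \x m2)%E.-integrable setT (EFin \o f) ->
  measurable_fun setT (fun y => \int[m1]_x f (x, y)).
Proof.
move=> if_; apply: measurableT_comp => //.
exact: (measurable_fubini_G if_).
Qed.

End RealFubini.

Section LebesgueTools.
Variable R : realType.
Local Notation mu := (@lebesgue_measure R).

Lemma lebesgue_measure_reflect (x : R) (A : set (measurableTypeR R)) :
  measurable A -> pushforward mu (fun y : R => x - y : measurableTypeR R) A = mu A.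
Proof.
move=> mA; apply/esym/lebesgue_measure_unique => //=.
  by apply: measurable_funB.
move=> mr _ [[a b]] _ <-; rewrite /pushforward.
have -> : (fun y : R => x - y) @^-1` `]a, b]%classic = `[x - b, x - a[%classic.
  apply/seteqP; split => y /=; rewrite !in_itv/= => /andP[? ?];
    by apply/andP; split; lra.
rewrite !lebesgue_measure_itv/= !lte_fin ltrD2l ltrN2.
by case: ifPn => // _; rewrite -!EFinB; congr EFin; lra.
Qed.

Lemma integrable_reflect (f : R -> R) (x : R) :
  mu.-integrable setT (EFin \o f) -> mu.-integrable setT (fun y => (f (x - y))%:E).
Proof.
move=> /integrableP[/measurable_EFinP mf foo].
have mr : measurable_fun setT (fun y : R => x - y).
  by apply: measurable_funB.
apply/integrableP; split.
  by apply/measurable_EFinP; exact: (measurableT_comp mf).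
apply: le_lt_trans foo.
rewrite [leRHS](_ : _ =
    \int[pushforward mu (fun y : R => (x - y)%R : measurableTypeR R)]_y
      `|(f y)%:E|)%E; last first.
  by apply: eq_measure_integral => A mA _; rewrite /= -(lebesgue_measure_reflect x mA).
rewrite ge0_integral_pushforward//.
by apply/measurable_EFinP; exact: measurableT_comp.
Qed.

Lemma integrable_oneDsqrV : mu.-integrable setT (fun y : R => ((1 + y ^+ 2)^-1)%:E).
Proof.
apply/integrableP; split.
  apply/measurable_EFinP; apply: continuous_measurable_fun; exact: continuous_oneDsqrV.
under eq_integral => y _.
  rewrite gee0_abs; last by rewrite lee_fin invr_ge0 addr_ge0// sqr_ge0.
  over.
rewrite (@ge0_symfun_integralT _ (fun y : R => (1 + y ^+ 2)^-1)).
- by rewrite -set_itvcy (@integral0y_oneDsqr R) -EFinM ltry.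
- by move=> y; rewrite invr_ge0 addr_ge0// sqr_ge0.
- exact: continuous_oneDsqrV.
- by move=> y /=; rewrite sqrrN.
Qed.

(** This is exp(- e x) for x >= 0 and 0 for x < 0: the exponential density
    divided by its rate. *)
Definition abel_weight (e x : R) : R := e^-1 * exponential_pdf e x.

Lemma abel_weight_integral (e : R) : 0 < e ->
  mu.-integrable setT (EFin \o abel_weight e) /\ \int[mu]_x abel_weight e x = e^-1.
Proof.
move=> e0; have ie := integrable_exponential_pdf e0; split.
  exact: (integrableZl measurableT e^-1 ie).
rewrite /abel_weight RintegralZl//.
by rewrite /Rintegral integral_exponential_pdf// mulr1.
Qed.

Lemma abel_weightE (e x : R) : 0 < e -> 0 <= x -> abel_weight e x = expR (- e * x).
Proof.
move=> e0 x0; rewrite /abel_weight exponential_pdfE// mulrA mulVf ?mul1r//.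
by rewrite gt_eqF.
Qed.

Lemma abel_weight_lt0 (e x : R) : x < 0 -> abel_weight e x = 0.
Proof.
move=> x0; rewrite /abel_weight /exponential_pdf patchE ifF ?mulr0//.
by apply/negbTE/negP; rewrite inE/= in_itv/= andbT leNgt x0.
Qed.

Lemma abel_weight_ge0 (e x : R) : 0 < e -> 0 <= abel_weight e x.
Proof.
by move=> e0; rewrite mulr_ge0// ?invr_ge0 ?exponential_pdf_ge0// ltW.
Qed.

Lemma abel_weight_le1 (e x : R) : 0 < e -> abel_weight e x <= 1.
Proof.
move=> e0; have [x0|x0] := leP 0 x; last by rewrite abel_weight_lt0.
by rewrite abel_weightE// -[leRHS]expR0 ler_expR mulNr oppr_le0 mulr_ge0// ltW.
Qed.

Lemma integral_setT_itvcy (f : R -> R) : measurable_fun setT f ->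
  (forall x, 0 <= f x) -> (forall x, x < 0 -> f x = 0) ->
  (\int[mu]_x (f x)%:E = \int[mu]_(x in `[0%R, +oo[) (f x)%:E)%E.
Proof.
move=> mf f0 fN; rewrite -(setUv `[0, +oo[%classic) ge0_integral_setU//=; last 4 first.
  exact: measurableC.
  by rewrite setUv; exact/measurable_EFinP.
  by move=> x _; rewrite lee_fin.
  exact/disj_setPCl.
rewrite [X in _ + X]integral0_eq ?adde0//.
by move=> x /=; rewrite in_itv/= andbT => /negP; rewrite -ltNge => /fN ->.
Qed.

Lemma cvg_expR_decay (e : R) : 0 < e -> (expR (- e * x)) @[x --> +oo] --> (0 : R).
Proof.
move=> e0; rewrite (_ : (fun x => _) = (fun z => expR (- z)) \o (fun z => e * z)); last first.
  by apply: eq_fun => x; rewrite mulNr.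
apply: (@cvg_comp _ _ _ _ _ _ (pinfty_nbhs R)); last exact: cvgr_expR.
exact: gt0_cvgMry.
Qed.

Lemma is_derive_damped_cos (e z x : R) : 0 < e ->
  is_derive x 1 (fun x => expR (- e * x) *
      (z * sin (z * x) - e * cos (z * x)) / (e ^+ 2 + z ^+ 2))
   (expR (- e * x) * cos (z * x)).
Proof.
move=> e0.
have de := is_derive_expM (- e) x.
have dz : is_derive x 1 (fun x => z * x) z.
  by apply: is_derive_eq; rewrite /GRing.scale/= !mulr1.
have ds := @is_derive1_comp R (@sin R) _ x _ _ (is_derive_sin _) dz.
have dc := @is_derive1_comp R (@cos R) _ x _ _ (is_derive_cos _) dz.
have d1 := is_deriveB (@is_deriveZ R R^o R^o _ z x 1 _ ds) (@is_deriveZ R R^o R^o _ e x 1 _ dc).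
have d2 := is_deriveM de d1.
have d3 := @is_deriveZ R R^o R^o _ ((e ^+ 2 + z ^+ 2)^-1) x 1 _ d2.
have n0 : e ^+ 2 + z ^+ 2 != 0 by rewrite gt_eqF// ltr_pwDl ?exprn_gt0 ?sqr_ge0.
have E : (fun x : R => expR (- e * x) *
      (z * sin (z * x) - e * cos (z * x)) / (e ^+ 2 + z ^+ 2)) =
  ((e ^+ 2 + z ^+ 2)^-1 \*: ((fun x : R => expR (- e * x)) *
    (z \*: (sin \o (fun x : R => z * x)) - e \*: (cos \o (fun x : R => z * x))))).
  by apply/funext => y; rewrite mulrC.
rewrite E {E}.
apply: (is_derive_eq d3); rewrite /GRing.scale /=.
set E := expR _; set s := sin _; set c := cos _.
suff : (e ^+ 2 + z ^+ 2)^-1 * (E * (z * (c * z) - e * (- s * z)) +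
    (z * s - e * c) * (- e * E)) = E * c by [].
by field.
Qed.

(** The fundamental theorem on a half line applies to nonnegative integrands,
    hence the detour through 1 + cos. *)
Lemma laplace_cos (e z : R) : 0 < e ->
  \int[mu]_x (abel_weight e x * cos (z * x)) = e / (e ^+ 2 + z ^+ 2).
Proof.
move=> e0; have [ie Ie] := abel_weight_integral e0.
have ccos : continuous (fun x : R => cos (z * x)).
  move=> x; apply: continuous_comp; last exact: continuous_cos.
  by apply: cvgM; [exact: cvg_cst|exact: cvg_id].
have mcos : measurable_fun setT (fun x : R => cos (z * x)) by exact: continuous_measurable_fun.
have mw : measurable_fun setT (abel_weight e) by case/integrableP : ie => /measurable_EFinP.
have iwc : mu.-integrable setT (EFin \o (fun x => abel_weight e x * cos (z * x))).
  apply: (integrable_dominated measurableT _ ie).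
    exact: measurable_funM.
  move=> x _; rewrite normrM ger0_norm ?abel_weight_ge0// ler_piMr ?abel_weight_ge0//.
  by rewrite ler_norml cos_geN1 cos_le1.
pose F (x : R) := - e^-1 * expR (- e * x) +
  expR (- e * x) * (z * sin (z * x) - e * cos (z * x)) / (e ^+ 2 + z ^+ 2).
have dF (x : R) : is_derive x 1 F (expR (- e * x) * (1 + cos (z * x))).
  have d1 := @is_deriveZ R R^o R^o _ (- e^-1) x 1 _ (is_derive_expM (- e) x).
  have := is_deriveD d1 (is_derive_damped_cos z x e0).
  rewrite /GRing.scale/= mulrDr mulr1.
  by rewrite mulNr mulNr mulrN opprK mulKf ?gt_eqF// -mulNr; exact.
have cF : continuous F.
  by move=> x; apply/differentiable_continuous/derivable1_diffP; have [] := dF x.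
have n0 : 0 < e ^+ 2 + z ^+ 2 by rewrite ltr_pwDl ?exprn_gt0 ?sqr_ge0.
have H : (\int[mu]_x (abel_weight e x * (1 + cos (z * x)))%:E =
    (e^-1 + e / (e ^+ 2 + z ^+ 2))%:E)%E.
  rewrite integral_setT_itvcy; first last.
  - by move=> x /abel_weight_lt0 ->; rewrite mul0r.
  - by move=> x; rewrite mulr_ge0 ?abel_weight_ge0// -lerBlDl sub0r cos_geN1.
  - by apply: measurable_funM => //; apply: measurable_funD.
  rewrite (@eq_integral _ _ _ mu _ (fun x => (expR (- e * x) * (1 + cos (z * x)))%:E)%R); last first.
    by move=> x; rewrite inE/= in_itv/= andbT => x0; rewrite abel_weightE.
  rewrite (@ge0_continuous_FTC2y _ _ F 0 0) ?sub0e.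
  - rewrite /F !mulr0 expR0 sin0 cos0 mulr0 sub0r !mulr1 mul1r.
    by rewrite -EFinN; congr EFin; field; rewrite !gt_eqF.
  - by move=> x _; rewrite mulr_ge0 ?expR_ge0// -lerBlDl sub0r cos_geN1.
  - apply: continuous_subspaceT => x; apply: cvgM.
      by have [/derivable1_diffP/differentiable_continuous] := is_derive_expM (- e) x.
    by apply: cvgD; [exact: cvg_cst|exact: ccos].
  - apply/cvgrPdist_le => k k0.
    pose K := e^-1 + (`|z| + e) / (e ^+ 2 + z ^+ 2).
    have K0 : 0 < K.
      by rewrite ltr_pwDl ?invr_gt0// divr_ge0 ?(ltW n0)// addr_ge0// ltW.
    have /cvgrPdist_le/(_ _ (divr_gt0 k0 K0)) := cvg_expR_decay e0.
    apply: filterS => x; rewrite !sub0r !normrN ger0_norm ?expR_ge0//.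
    rewrite ler_pdivlMr// => /(le_trans _); apply.
    have -> : F x = expR (- e * x) *
        (- e^-1 + (z * sin (z * x) - e * cos (z * x)) / (e ^+ 2 + z ^+ 2)).
      by rewrite /F; field; rewrite !gt_eqF.
    rewrite normrM ger0_norm ?expR_ge0//.
    rewrite ler_wpM2l ?expR_ge0// /K (le_trans (ler_normD _ _))//.
    rewrite normrN ger0_norm ?invr_ge0 ?(ltW e0)// lerD2l normrM normfV.
    rewrite (ger0_norm (ltW n0)) ler_wpM2r ?invr_ge0 ?(ltW n0)//.
    rewrite (le_trans (ler_normB _ _))// !normrM lerD//.
      by rewrite ler_piMr// ler_norml sin_geN1 sin_le1.
    by rewrite (ger0_norm (ltW e0)) ler_piMr ?(ltW e0)// ler_norml cos_geN1 cos_le1.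
  - by move=> x _; have [] := dF x.
  - by apply: cvg_at_right_filter; exact: cF.
  - by move=> x _; rewrite derive1E; have [_] := dF x.
have : \int[mu]_x (abel_weight e x * (1 + cos (z * x))) = e^-1 + e / (e ^+ 2 + z ^+ 2).
  by rewrite /Rintegral H.
under eq_Rintegral do rewrite mulrDr mulr1.
by rewrite RintegralD// Ie => /addrI.
Qed.

End LebesgueTools.

(** * Cosine and sine transforms *)
Section BoundedKernel.
Context d1 d2 {T1 : measurableType d1} {T2 : measurableType d2} {R : realType}.
Variables (m1 : {sigma_finite_measure set T1 -> \bar R})
          (m2 : {sigma_finite_measure set T2 -> \bar R}).
Variables (V : T1 -> R) (G : T2 -> R) (K : T1 * T2 -> R).
Hypotheses (iV : m1.-integrable setT (EFin \o V)) (iG : m2.-integrable setT (EFin \o G))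
  (mK : measurable_fun setT K) (K1 : forall p, `|K p| <= 1).

Let mV : measurable_fun setT V.
Proof. by case/integrableP : iV => /measurable_EFinP. Qed.

Let mG : measurable_fun setT G.
Proof. by case/integrableP : iG => /measurable_EFinP. Qed.

Lemma integrable_bounded_kernel :
  (m1 \x m2)%E.-integrable setT (EFin \o (fun p => V p.1 * G p.2 * K p)).
Proof.
have mf : measurable_fun setT (fun p : T1 * T2 => V p.1 * G p.2 * K p).
  apply: measurable_funM => //; apply: measurable_funM.
    exact: (measurableT_comp mV measurable_fst).
  exact: (measurableT_comp mG measurable_snd).
apply/integrable12ltyP; first exact/measurable_EFinP.
pose cG := (\int[m2]_y `|(G y)%:E|)%E.
have cG_fin : cG \is a fin_num.
  have /integrableP[_ h] := iG.
  by rewrite ge0_fin_numE//; exact: integral_ge0.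
have /integrableP[_ hV] := iV.
apply: (@le_lt_trans _ _ (\int[m1]_x (cG * `|(V x)%:E|))%E).
  apply: ge0_le_integral => //=.
  - by move=> x _; exact: integral_ge0.
  - apply: (measurable_fun_fubini_tonelli_F (fun p => `|(V p.1 * G p.2 * K p)%:E|)%E) => //.
    by apply/measurable_EFinP; exact: measurableT_comp.
  - apply: emeasurable_funM; first exact: measurable_cst.
    by apply/measurable_EFinP; exact: measurableT_comp.
  - move=> x _; rewrite muleC /cG -ge0_integralZl//=; last first.
      by apply/measurable_EFinP; exact: measurableT_comp.
    apply: ge0_le_integral => //=.
    + apply/measurable_EFinP; apply: measurableT_comp => //.
      exact: (measurableT_comp mf (@measurable_pair1 _ _ T1 T2 x)).
    + apply: emeasurable_funM; first exact: measurable_cst.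
      by apply/measurable_EFinP; exact: measurableT_comp.
    + by move=> y _; rewrite -EFinM lee_fin -normrM [leLHS]normrM ler_piMr.
rewrite ge0_integralZl//=.
- by apply: lte_mul_pinfty => //; exact: integral_ge0.
- by apply/measurable_EFinP; exact: measurableT_comp.
- exact: integral_ge0.
Qed.

Lemma Rintegral_Fubini_bounded_kernel :
  \int[m1]_x (V x * \int[m2]_y (G y * K (x, y))) =
  \int[m2]_y (G y * \int[m1]_x (V x * K (x, y))).
Proof.
have mK1 x : measurable_fun setT (fun y => K (x, y)).
  exact: (measurableT_comp mK (@measurable_pair1 _ _ T1 T2 x)).
have mK2 y : measurable_fun setT (fun x => K (x, y)).
  exact: (measurableT_comp mK (@measurable_pair2 _ _ T1 T2 y)).
have i2 x : m2.-integrable setT (fun y => (G y * K (x, y))%:E).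
  apply: (integrable_dominated measurableT (f := fun y => G y * K (x, y))) (integrable_norm iG) _.
    exact: measurable_funM.
  by move=> y _; rewrite normrM ler_piMr.
have i1 y : m1.-integrable setT (fun x => (V x * K (x, y))%:E).
  apply: (integrable_dominated measurableT (f := fun x => V x * K (x, y))) (integrable_norm iV) _.
    exact: measurable_funM.
  by move=> x _; rewrite normrM ler_piMr.
transitivity (\int[m1]_x \int[m2]_y (V x * G y * K (x, y))).
  apply: eq_Rintegral => x _; rewrite -RintegralZl//; last exact: i2.
  by apply: eq_Rintegral => y _; rewrite mulrA.
transitivity (\int[m2]_y \int[m1]_x (V x * G y * K (x, y))); last first.
  apply: eq_Rintegral => y _; rewrite -RintegralZl//; last exact: i1.
  by apply: eq_Rintegral => x _; rewrite mulrCA mulrA.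
apply: (Rintegral_Fubini integrable_bounded_kernel) => /=.
- move=> x; have := integrableZl measurableT (V x) (i2 x).
  by apply: eq_integrable => // y _; rewrite -EFinM mulrA.
- move=> y; have := integrableZl measurableT (G y) (i1 y).
  by apply: eq_integrable => // x _; rewrite -EFinM mulrCA mulrA.
Qed.

End BoundedKernel.

Section FourierInversion.
Variable R : realType.
Local Notation mu := (@lebesgue_measure R).

Section CosineTransforms.
Variables (V : R -> R) (iV : mu.-integrable setT (EFin \o V)).

Definition cosine_transform (xi : R) := \int[mu]_y (V y * cos (y * xi)).
Definition sine_transform (xi : R) := \int[mu]_y (V y * sin (y * xi)).

Let mV : measurable_fun setT V.
Proof. by case/integrableP : iV => /measurable_EFinP. Qed.

Lemma measurable_cosX (z : R) : measurable_fun setT (fun y : R => cos (y * z)).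
Proof.
apply: continuous_measurable_fun => y; apply: continuous_comp; last exact: continuous_cos.
by apply: cvgM; [exact: cvg_id|exact: cvg_cst].
Qed.

Lemma measurable_sinX (z : R) : measurable_fun setT (fun y : R => sin (y * z)).
Proof.
apply: continuous_measurable_fun => y; apply: continuous_comp; last exact: continuous_sin.
by apply: cvgM; [exact: cvg_id|exact: cvg_cst].
Qed.

Lemma integrable_cos (z : R) : mu.-integrable setT (EFin \o (fun y => V y * cos (y * z))).
Proof.
apply: (integrable_dominated measurableT _ (integrable_norm iV)).
  by apply: measurable_funM => //; exact: measurable_cosX.
by move=> x _ /=; rewrite normrM ler_piMr// ler_norml cos_geN1 cos_le1.
Qed.

Lemma integrable_sin (z : R) : mu.-integrable setT (EFin \o (fun y => V y * sin (y * z))).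
Proof.
apply: (integrable_dominated measurableT _ (integrable_norm iV)).
  by apply: measurable_funM => //; exact: measurable_sinX.
by move=> x _ /=; rewrite normrM ler_piMr// ler_norml sin_geN1 sin_le1.
Qed.

Lemma measurable_mul_pair : measurable_fun setT
  (fun p : measurableTypeR R * measurableTypeR R => p.1 * p.2 : R).
Proof. by apply: measurable_funM; [exact: measurable_fst|exact: measurable_snd]. Qed.

Let gauss_gt0 (y : R) : 0 < gauss_fun y. Proof. exact: expR_gt0. Qed.

(** A Gaussian factor in xi makes the kernel integrable in both variables;
    Fubini's theorem then gives measurability, and the factor is divided out. *)
Lemma measurable_cosine_transform : measurable_fun setT cosine_transform.
Proof.
have mK : measurable_fun setT
    (fun p : measurableTypeR R * measurableTypeR R => cos (p.1 * p.2)).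
  apply: measurableT_comp; last exact: measurable_mul_pair.
  by apply: continuous_measurable_fun; exact: continuous_cos.
have K1 (p : measurableTypeR R * measurableTypeR R) : `|cos (p.1 * p.2)| <= 1.
  by rewrite ler_norml cos_geN1 cos_le1.
have := measurable_Rintegral_param (integrable_bounded_kernel iV (@integrableT_gauss R) mK K1).
set F := fun y => _ => mF.
rewrite (_ : cosine_transform = fun y => F y * (gauss_fun y)^-1); last first.
  apply/funext => y; rewrite /F.
  have := gauss_gt0 y; move: (gauss_fun y) => g g0.
  under eq_Rintegral do rewrite /= -mulrA mulrCA.
  rewrite RintegralZl; [|exact: measurableT|exact: integrable_cos].
  by rewrite mulrAC mulfV ?mul1r// gt_eqF.
apply: measurable_funM => //; apply: continuous_measurable_fun => y.
by apply: cvgV; [rewrite gt_eqF|exact: continuous_gauss_fun].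
Qed.

Lemma measurable_sine_transform : measurable_fun setT sine_transform.
Proof.
have mK : measurable_fun setT
    (fun p : measurableTypeR R * measurableTypeR R => sin (p.1 * p.2)).
  apply: measurableT_comp; last exact: measurable_mul_pair.
  by apply: continuous_measurable_fun; exact: continuous_sin.
have K1 (p : measurableTypeR R * measurableTypeR R) : `|sin (p.1 * p.2)| <= 1.
  by rewrite ler_norml sin_geN1 sin_le1.
have := measurable_Rintegral_param (integrable_bounded_kernel iV (@integrableT_gauss R) mK K1).
set F := fun y => _ => mF.
rewrite (_ : sine_transform = fun y => F y * (gauss_fun y)^-1); last first.
  apply/funext => y; rewrite /F.
  have := gauss_gt0 y; move: (gauss_fun y) => g g0.
  under eq_Rintegral do rewrite /= -mulrA mulrCA.
  rewrite RintegralZl; [|exact: measurableT|exact: integrable_sin].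
  by rewrite mulrAC mulfV ?mul1r// gt_eqF.
apply: measurable_funM => //; apply: continuous_measurable_fun => y.
by apply: cvgV; [rewrite gt_eqF|exact: continuous_gauss_fun].
Qed.

(** The Poisson kernel is the cosine transform of the Abel weight; exchanging
    the integrals moves the smoothing of V to the Fourier side. *)
Lemma poisson_integral (e x : R) : 0 < e ->
  \int[mu]_y (V y * (e / (e ^+ 2 + (x - y) ^+ 2))) =
  \int[mu]_xi (abel_weight e xi *
     (cos (x * xi) * cosine_transform xi + sin (x * xi) * sine_transform xi)).
Proof.
move=> e0.
have mK : measurable_fun setT
    (fun p : measurableTypeR R * measurableTypeR R => cos ((x - p.1) * p.2)).
  apply: (@measurableT_comp _ _ _ _ _ _ (@cos R)).
    by apply: continuous_measurable_fun; exact: continuous_cos.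
  apply: measurable_funM; last exact: measurable_snd.
  by apply: measurable_funB => //; exact: measurable_fst.
have K1 (p : measurableTypeR R * measurableTypeR R) : `|cos ((x - p.1) * p.2)| <= 1.
  by rewrite ler_norml cos_geN1 cos_le1.
have := Rintegral_Fubini_bounded_kernel iV (abel_weight_integral e0).1 mK K1.
under eq_Rintegral => y _ do rewrite /= laplace_cos//.
move=> ->; apply: eq_Rintegral => xi _; congr (_ * _).
rewrite /cosine_transform /sine_transform -!RintegralZl//;
  [|exact: integrable_sin|exact: integrable_cos].
rewrite -RintegralD//; last 2 first.
  exact: (integrableZl measurableT _ (integrable_cos xi)).
  exact: (integrableZl measurableT _ (integrable_sin xi)).
apply: eq_Rintegral => y _ /=; rewrite mulrBl cosB; ring.
Qed.

End CosineTransforms.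

End FourierInversion.

(** * Integral bounds and limits of extended reals *)
Lemma cvge0_lt (R : realType) (T : Type) (F : set_system T) {FF : Filter F}
    (f : T -> \bar R) (e : R) :
  f @ F --> 0%E -> 0 < e -> \forall x \near F, (f x < e%:E)%E.
Proof.
move=> /fine_cvgP[fin /cvgrPdist_lt/(_ e) h] e0.
near=> x.
have fx : f x \is a fin_num by near: x.
have : `|0 - fine (f x)| < e by near: x; exact: h.
rewrite sub0r normrN => /ltr_normlW; rewrite -lte_fin fineK//.
Unshelve. all: by end_near. Qed.

Arguments cvge0_lt {R T F FF f e}.

Lemma cvge0_le (R : realType) (T : Type) (F : set_system T) {FF : Filter F}
    (f : T -> \bar R) :
  (forall x, (0 <= f x)%E) ->
  (forall e : R, 0 < e -> \forall x \near F, (f x <= e%:E)%E) -> f @ F --> 0%E.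
Proof.
move=> f0 h; apply/fine_cvgP; split.
  have := h 1 ltr01; apply: filterS => x fx.
  by rewrite ge0_fin_numE// (le_lt_trans fx)// ltry.
apply/cvgrPdist_le => e e0; have := h e e0; apply: filterS => x fx.
have fin : f x \is a fin_num by rewrite ge0_fin_numE// (le_lt_trans fx)// ltry.
by rewrite sub0r normrN ger0_norm ?fine_ge0// -lee_fin fineK.
Qed.

Section IntegralBounded.
Context d {T : measurableType d} {R : realType}.
Variable mu : {measure set T -> \bar R}.

Implicit Types (f g : T -> R).

Definition integral_le (f : T -> R) (M : R) :=
  mu.-integrable setT (EFin \o f) /\ \int[mu]_x f x <= M.

Lemma integral_leD f g (M N : R) : integral_le f M -> integral_le g N ->
  integral_le (fun x => f x + g x) (M + N).
Proof.
move=> [f1 f2] [g1 g2]; split; first exact: (integrableD measurableT f1 g1).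
by rewrite RintegralD// lerD.
Qed.

Lemma integral_leZ (k : R) f (M : R) : 0 <= k -> integral_le f M ->
  integral_le (fun x => k * f x) (k * M).
Proof.
move=> k0 [f1 f2]; split; first exact: (integrableZl measurableT k f1).
by rewrite RintegralZl// ler_wpM2l.
Qed.

Lemma integral_le_ge0 f (M : R) : measurable_fun setT f -> (forall x, 0 <= f x) ->
  (\int[mu]_x (f x)%:E <= M%:E)%E -> integral_le f M.
Proof.
move=> mf f0 fM.
have if_ : mu.-integrable setT (EFin \o f).
  apply/integrableP; split; first exact/measurable_EFinP.
  under eq_integral do rewrite /= ger0_norm//.
  exact: le_lt_trans fM (ltry _).
split => //; rewrite -lee_fin /Rintegral fineK//; exact: integrable_fin_num.
Qed.

Lemma integral_le_norm f g (M : R) : measurable_fun setT f -> integral_le g M ->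
  (forall x, `|f x| <= g x) -> `|\int[mu]_x f x| <= M.
Proof.
move=> mf [ig gM] fg; apply: le_trans gM.
by apply: norm_Rintegral_le => // x _.
Qed.

End IntegralBounded.

(** * Smoothing by the Poisson kernel *)
Section PoissonSmoothing.
Variable R : realType.
Local Notation mu := (@lebesgue_measure R).

Lemma integral_le_oneDsqrV : integral_le mu (fun y : R => (1 + y ^+ 2)^-1) pi.
Proof.
split; first exact: integrable_oneDsqrV.
rewrite /Rintegral (@ge0_symfun_integralT _ (fun y : R => (1 + y ^+ 2)^-1)).
- by rewrite -set_itvcy (@integral0y_oneDsqr R) -EFinM/= mulrCA mulfV ?mulr1// pnatr_eq0.
- by move=> y; rewrite invr_ge0 addr_ge0// sqr_ge0.
- exact: continuous_oneDsqrV.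
- by move=> y /=; rewrite sqrrN.
Qed.

(** With X = 1 / (1 + x^2), this is the arithmetic-geometric mean inequality
    for r X and (1 + |x|)^2 a^2 / (r X), combined with
    (1 + |x|)^2 <= 2 (1 + x^2).  Both terms on the right can be integrated when
    a is the Fourier transform of a function in H^2. *)
Lemma weighted_amgm (r x a : R) : 0 < r ->
  (1 + `|x|) * `|a| <= 2^-1 * (r * (1 + x ^+ 2)^-1) + (1 + x ^+ 2) ^+ 2 * a ^+ 2 / r.
Proof.
move=> r0; have X0 : 0 < 1 + x ^+ 2 by rewrite ltr_pwDl// sqr_ge0.
have x0 := normr_ge0 x; have a0 := normr_ge0 a.
rewrite -(real_normK (num_real x)) -(real_normK (num_real a)).
rewrite -(real_normK (num_real x)) in X0.
move: (Num.norm x) (Num.norm a) x0 a0 X0 => {}x {}a x0 a0 X0.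
rewrite -(ler_pM2r (mulr_gt0 r0 X0)).
have -> : (2^-1 * (r * (1 + x ^+ 2)^-1) + (1 + x ^+ 2) ^+ 2 * a ^+ 2 / r) * (r * (1 + x ^+ 2)) =
   2^-1 * r ^+ 2 + (1 + x ^+ 2) ^+ 3 * a ^+ 2 by field; rewrite !gt_eqF.
pose q := (1 + x) * a * (1 + x ^+ 2).
have h1 : 0 <= (r - q) ^+ 2 by exact: sqr_ge0.
have h2 : (1 + x) ^+ 2 <= 2 * (1 + x ^+ 2) by have := sqr_ge0 (1 - x); lra.
have h3 : 0 <= (2 * (1 + x ^+ 2) - (1 + x) ^+ 2) * (a ^+ 2 * (1 + x ^+ 2) ^+ 2).
  by rewrite mulr_ge0// ?subr_ge0// mulr_ge0 ?sqr_ge0.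
move: h1 h3; rewrite /q; lra.
Qed.

Lemma measurable_oneDsqr_powR (s : R) : measurable_fun setT (fun x : R => (1 + x ^+ 2) `^ s).
Proof.
apply: (measurableT_comp (measurable_powR s)).
apply: continuous_measurable_fun; exact: continuous_oneDsqr.
Qed.

Lemma oneDsqr_powR_ge (s x : R) : 2 <= s -> (1 + x ^+ 2) ^+ 2 <= (1 + x ^+ 2) `^ s.
Proof.
move=> s2; rewrite -powR_mulrn ?addr_ge0 ?sqr_ge0// ler_powR//.
by rewrite lerDl sqr_ge0.
Qed.

(** Here A and B are the transforms of a truncated function and a, b those of
    the function itself.  Passing from A, B to a, b costs an error in L^2, split
    off by the arithmetic-geometric mean inequality with parameter theta; what
    remains is bounded by weighted_amgm. *)
Lemma fourier_pairing_bound (s r omega e theta eta : R) (a b A B c d : R -> R) :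
  2 <= s -> 0 < r -> 0 <= omega -> 0 < e -> 0 < theta -> 0 <= eta ->
  measurable_fun setT a -> measurable_fun setT b ->
  measurable_fun setT A -> measurable_fun setT B ->
  measurable_fun setT c -> measurable_fun setT d ->
  (\int[mu]_xi ((1 + xi ^+ 2) `^ s * (a xi ^+ 2 + b xi ^+ 2))%:E <= (r ^+ 2)%:E)%E ->
  (\int[mu]_xi ((A xi - a xi) ^+ 2)%:E <= eta%:E)%E ->
  (\int[mu]_xi ((B xi - b xi) ^+ 2)%:E <= eta%:E)%E ->
  (forall xi, `|c xi| <= 2) -> (forall xi, `|d xi| <= 2) ->
  (forall xi, `|c xi| <= omega * (1 + `|xi|)) ->
  (forall xi, `|d xi| <= omega * (1 + `|xi|)) ->
  `|\int[mu]_xi (abel_weight e xi * (c xi * A xi + d xi * B xi))| <=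
    omega * r * (pi + 1) + 2 * theta / e + 2 * eta / theta.
Proof.
move=> s2 r0 om0 e0 th0 eta0 ma mb mA mB mc md J hA hB c2 d2 co do_.
have [iw Iw] := abel_weight_integral e0.
have mw : measurable_fun setT (abel_weight e) by case/integrableP : iw => /measurable_EFinP.
pose g xi := omega * (r * (1 + xi ^+ 2)^-1 +
      r^-1 * ((1 + xi ^+ 2) `^ s * (a xi ^+ 2 + b xi ^+ 2)))
   + (2 * theta * abel_weight e xi +
     (theta^-1 * (A xi - a xi) ^+ 2 + theta^-1 * (B xi - b xi) ^+ 2)).
have ig : integral_le mu g (omega * (r * pi + r^-1 * r ^+ 2) +
    (2 * theta * e^-1 + (theta^-1 * eta + theta^-1 * eta))).
  apply: integral_leD.
    apply: integral_leZ => //; apply: integral_leD.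
      by apply: integral_leZ; [exact: ltW|exact: integral_le_oneDsqrV].
    apply: integral_leZ; first by rewrite invr_ge0 ltW.
    apply: integral_le_ge0 => //.
      apply: measurable_funM; first exact: measurable_oneDsqr_powR.
      by apply: measurable_funD; exact: measurable_funX.
    by move=> xi; rewrite mulr_ge0 ?powR_ge0// addr_ge0// sqr_ge0.
  apply: integral_leD.
    apply: integral_leZ; first by rewrite mulr_ge0// ltW.
    by split => //; rewrite Iw.
  by apply: integral_leD; (apply: integral_leZ; first by rewrite invr_ge0 ltW);
     apply: integral_le_ge0 => //; do ?[by move=> x; exact: sqr_ge0];
     apply: measurable_funX; exact: measurable_funB.
have -> : omega * r * (pi + 1) + 2 * theta / e + 2 * eta / theta =
  omega * (r * pi + r^-1 * r ^+ 2) + (2 * theta * e^-1 + (theta^-1 * eta + theta^-1 * eta)).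
  by field; rewrite !gt_eqF.
apply: integral_le_norm ig _.
  by apply: measurable_funM => //; apply: measurable_funD; exact: measurable_funM.
move=> xi; have w0 := abel_weight_ge0 xi e0; have w1 := abel_weight_le1 xi e0.
have ww : abel_weight e xi ^+ 2 <= abel_weight e xi by rewrite expr2 ler_piMr.
rewrite normrM ger0_norm//; rewrite /g; set w := abel_weight e xi in w0 w1 ww *.
have key (p q k : R) : `|k| <= 2 -> `|k| <= omega * (1 + `|xi|) ->
    w * `|k * p| <= omega * (2^-1 * (r * (1 + xi ^+ 2)^-1) + (1 + xi ^+ 2) `^ s * q ^+ 2 / r)
     + (theta * w + theta^-1 * (p - q) ^+ 2).
  move=> k2 ko.
  have h1 : w * `|k * p| <= `|k * q| + w * (2 * `|p - q|).
    have -> : k * p = k * q + k * (p - q) by ring.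
    rewrite (le_trans (ler_wpM2l w0 (ler_normD _ _)))// mulrDr lerD//.
      by rewrite ler_piMl.
    by rewrite ler_wpM2l// normrM ler_wpM2r.
  apply: le_trans h1 _; apply: lerD.
    have h2 : `|k| * `|q| <= omega * ((1 + `|xi|) * `|q|) by rewrite mulrA ler_wpM2r.
    rewrite normrM (le_trans h2)// ler_wpM2l//.
    rewrite (le_trans (weighted_amgm xi q r0))// lerD2l ler_wpM2r ?invr_ge0 ?(ltW r0)//.
    by rewrite ler_wpM2r ?sqr_ge0// oneDsqr_powR_ge.
  rewrite -(real_normK (num_real (p - q))).
  set z := Num.norm (p - q).
  apply: (@le_trans _ _ (theta * w ^+ 2 + theta^-1 * z ^+ 2)); last first.
    by rewrite lerD2r ler_wpM2l// ltW.
  rewrite -subr_ge0.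
  have -> : theta * w ^+ 2 + theta^-1 * z ^+ 2 - w * (2 * z) = theta * (w - z / theta) ^+ 2.
    by field; rewrite gt_eqF.
  by rewrite mulr_ge0 ?sqr_ge0// ltW.
have := key (A xi) (a xi) (c xi) (c2 xi) (co xi).
have := key (B xi) (b xi) (d xi) (d2 xi) (do_ xi).
have := ler_wpM2l w0 (ler_normD (c xi * A xi) (d xi * B xi)).
lra.
Qed.

Local Notation poisson e x := (fun y : R => e / (e ^+ 2 + (x - y) ^+ 2)).

Lemma continuous_poisson (e x : R) : 0 < e -> continuous (poisson e x).
Proof.
move=> e0 y; apply: cvgM; first exact: cvg_cst.
apply: cvgV; first by rewrite gt_eqF// ltr_pwDl ?exprn_gt0 ?sqr_ge0.
apply: cvgD; first exact: cvg_cst.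
apply: (@continuous_comp _ _ _ (fun z : R => x - z) (fun z : R => z ^+ 2));
  last exact: exprn_continuous.
by apply: cvgB; [exact: cvg_cst|exact: cvg_id].
Qed.

Lemma integral_poisson_kernel (e x delta : R) : 0 < e -> 0 < delta ->
  integral_le mu (poisson e x \_ `[x - delta, x + delta]) pi /\
  \int[mu]_y ((poisson e x \_ `[x - delta, x + delta]) y) = 2 * atan (delta / e).
Proof.
move=> e0 d0; have xx : x - delta < x + delta by lra.
have cP := @continuous_poisson e x e0.
pose F (y : R) := - atan ((x - y) / e).
have dF (y : R) : is_derive y 1 F (poisson e x y).
  have d1 : is_derive y 1 (fun y : R => (x - y) / e) (- e^-1).
    have -> : (fun y : R => (x - y) / e) = e^-1 \*: (cst x - id).
      by apply/funext => z; rewrite mulrC.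
    apply: (is_derive_eq (is_deriveZ e^-1 (is_deriveB (is_derive_cst x y 1) (is_derive_id y 1)))).
    by rewrite /GRing.scale/= sub0r mulrN1.
  have d2 := is_deriveN (@is_derive1_comp R (@atan R) _ y _ _ (is_derive1_atan _) d1).
  apply: (is_derive_eq d2); rewrite /= mulrN opprK.
  by field; rewrite !gt_eqF// ltr_pwDl ?exprn_gt0 ?sqr_ge0.
have cF : continuous F.
  by move=> y; apply/differentiable_continuous/derivable1_diffP; have [] := dF y.
have iP : mu.-integrable `[x - delta, x + delta] (EFin \o poisson e x).
  by apply: continuous_compact_integrable; [exact: segment_compact|exact: continuous_subspaceT].
have E : \int[mu]_y ((poisson e x \_ `[x - delta, x + delta]) y) = 2 * atan (delta / e).
  rewrite -Rintegral_mkcond /Rintegral (@continuous_FTC2 _ _ F)//.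
  - rewrite /F -EFinB/= opprK.
    have -> : (x - (x - delta)) / e = delta / e by congr (_ / _); lra.
    have -> : (x - (x + delta)) / e = - (delta / e) by rewrite -mulNr; congr (_ / _); lra.
    by rewrite atanN; lra.
  - exact: continuous_subspaceT.
  - split.
    + by move=> y _; have [] := dF y.
    + by apply: cvg_at_right_filter; exact: cF.
    + by apply: cvg_at_left_filter; exact: cF.
  - by move=> y _; rewrite derive1E; have [_] := dF y.
split=> //; split.
  by rewrite -restrict_EFin; apply/integrable_restrict => //; rewrite setTI.
by rewrite E; have := atan_ltpi2 (delta / e); lra.
Qed.

(** Away from x the kernel is at most e / (x - y)^2, and the product with |v| is
    split by the arithmetic-geometric mean inequality. *)
Lemma poisson_tail (e x y v d : R) : 0 < e -> 0 < d -> d <= `|x - y| ->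
  `|v| * poisson e x y <=
    e / 2 * (v ^+ 2 + d ^- 2 * (d ^- 2 + 1) * (1 + (x - y) ^+ 2)^-1).
Proof.
move=> e0 d0 dxy.
have yd : d ^+ 2 <= (x - y) ^+ 2.
  by rewrite -(real_normK (num_real (x - y))) lerXn2r ?nnegrE ?(ltW d0).
have d20 : 0 < d ^+ 2 by rewrite exprn_gt0.
move: ((x - y) ^+ 2) yd => z yd.
have z0 : 0 < z by exact: lt_le_trans yd.
have h1 : e / (e ^+ 2 + z) <= e * z^-1.
  rewrite ler_wpM2l ?(ltW e0)// lef_pV2 ?posrE ?ltr_wpDl ?sqr_ge0//.
  by rewrite lerDr sqr_ge0.
have h2 : z^-1 ^+ 2 <= d ^- 2 * (d ^- 2 + 1) * (1 + z)^-1.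
  have z1 : 0 < 1 + z by rewrite ltr_wpDl.
  have zq : z^-1 <= d ^- 2 by rewrite lef_pV2.
  have zi0 : 0 <= z^-1 by rewrite invr_ge0 ltW.
  rewrite ler_pdivlMr//.
  have -> : z^-1 ^+ 2 * (1 + z) = z^-1 * (z^-1 + 1) by field; rewrite gt_eqF.
  by rewrite ler_pM// ?addr_ge0// lerD2r.
have h3 : `|v| * z^-1 <= 2^-1 * (v ^+ 2 + z^-1 ^+ 2).
  rewrite -(real_normK (num_real v)).
  by have := sqr_ge0 (`|v| - z^-1); lra.
have := ler_wpM2l (normr_ge0 v) h1.
have := ler_wpM2l (ltW e0) h3.
have := ler_wpM2l (ltW e0) h2.
lra.
Qed.

(** The kernel has total mass pi and concentrates at x, where v is continuous.
    Away from x only the square integrability of v is available: there the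
    contribution is O(e) by poisson_tail, uniformly in n. *)
Lemma poisson_limit (v : R -> R) (x kappa : R) : continuous v ->
  mu.-integrable setT (EFin \o (fun y => v y ^+ 2)) -> 0 < kappa ->
  exists2 delta : R, 0 < delta & forall e : R, 0 < e < delta ->
    exists n0 : nat, forall n, (n0 <= n)%N ->
    `|\int[mu]_y ((v \_ `[- n%:R, n%:R]) y * poisson e x y) - pi * v x| <= kappa.
Proof.
move=> cv iv2 k0; have pi0 := @pi_gt0 R.
(* The error kappa is shared by the part near x, the part away from x, and
   the missing mass of the kernel near x. *)
pose k' := kappa / (3 * pi).
have k'0 : 0 < k' by rewrite divr_gt0// mulr_gt0.
have /cvgrPdist_lt/(_ _ k'0)/nbhs_ballP[d' /= d'0 hd'] := cv x.
pose d := d' / 2; have d0 : 0 < d by rewrite divr_gt0.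
have hd (y : R) : x - d <= y <= x + d -> `|v y - v x| <= k'.
  move=> /andP[y1 y2]; rewrite distrC ltW//; apply: hd'.
  rewrite /ball/= ltr_norml; apply/andP; split; move: d'0 y1 y2; rewrite /d; lra.
pose C := d ^- 2 * (d ^- 2 + 1).
have C0 : 0 <= C by rewrite mulr_ge0 ?addr_ge0 ?invr_ge0 ?sqr_ge0.
pose I1 := \int[mu]_y (1 + (x - y) ^+ 2)^-1.
have iI1 : integral_le mu (fun y => (1 + (x - y) ^+ 2)^-1) I1.
  by split => //; exact: (integrable_reflect x (@integrable_oneDsqrV R)).
pose Q := \int[mu]_y (v y ^+ 2) + C * I1.
have iQ : integral_le mu (fun y => v y ^+ 2 + C * (1 + (x - y) ^+ 2)^-1) Q.
  by apply: integral_leD; [split|apply: integral_leZ].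
have Q0 : 0 <= Q.
  apply: addr_ge0; first by apply: Rintegral_ge0 => y _; exact: sqr_ge0.
  rewrite mulr_ge0//; apply: Rintegral_ge0 => y _.
  by rewrite invr_ge0 addr_ge0// sqr_ge0.
pose m := kappa / (6 * (`|v x| + 1)).
have vx1 : 0 < `|v x| + 1 by rewrite ltr_wpDl.
have m0 : 0 < m by rewrite divr_gt0// mulr_gt0.
have /cvgrPdist_le/(_ _ m0)[M [_ hM]] := @cvgy_atan R.
exists (Num.min (d / (`|M| + 1)) (2 * kappa / (3 * (Q + 1)))).
  by rewrite lt_min !divr_gt0// ?mulr_gt0// ltr_wpDl.
move=> e /andP[e0]; rewrite lt_min => /andP[e1 e2].
have eQ : e * Q <= 2 * kappa / 3.
  move: e2; rewrite ltr_pdivlMr ?mulr_gt0 ?ltr_wpDl// => e2.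
  by have := mulr_ge0 (ltW e0) Q0; move: e2 e0; lra.
have {}hM : `|pi / 2 - atan (d / e)| <= m.
  apply: hM; rewrite ltr_pdivlMr//.
  move: e1; rewrite ltr_pdivlMr ?ltr_wpDl// => e1.
  apply: le_lt_trans e1; rewrite mulrC ler_wpM2l ?(ltW e0)//.
  by have := ler_norm M; lra.
pose n0 := (Num.truncn (`|x| + d)).+1.
exists n0 => n n0n.
have n0x : `|x| + d <= n%:R.
  apply: (@le_trans _ _ n0%:R); last by rewrite ler_nat.
  by apply: ltW; rewrite /n0 truncnS_gt.
have /andP[n1 n2] : (- n%:R <= x - d) && (x + d <= n%:R).
  have := ler_norm x; have := ler_norm (- x); rewrite normrN => ? ?.
  by apply/andP; split; lra.
have [iPI EPI] := integral_poisson_kernel x e0 d0.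
set I := `[x - d, x + d]%classic in iPI EPI.
set V := v \_ _.
have P0 (y : R) : 0 <= poisson e x y.
  by rewrite divr_ge0 ?addr_ge0 ?sqr_ge0// ltW.
have iVP : mu.-integrable setT (EFin \o (fun y => V y * poisson e x y)).
  have iV : mu.-integrable setT (EFin \o V).
    rewrite /V -restrict_EFin; apply/integrable_restrict => //; rewrite setTI.
    by apply: continuous_compact_integrable; [exact: segment_compact|exact: continuous_subspaceT].
  apply: (integrable_dominated measurableT _ (integrableZl measurableT e^-1 (integrable_norm iV))).
    apply: measurable_funM; first by case/integrableP : iV => /measurable_EFinP.
    by apply: continuous_measurable_fun; exact: continuous_poisson.
  move=> y _ /=; rewrite normrM mulrC ler_wpM2r// ger0_norm//.
  rewrite ler_pdivrMr ?ltr_pwDl ?exprn_gt0 ?sqr_ge0//.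
  rewrite mulrDr expr2 mulKf ?gt_eqF// lerDl mulr_ge0 ?sqr_ge0// invr_ge0 ltW//.
pose f y := V y * poisson e x y - v x * (poisson e x \_ I) y.
have mf : measurable_fun setT f.
  apply: measurable_funB; first by case/integrableP : iVP => /measurable_EFinP.
  by apply: measurable_funM => //; case: iPI => /integrableP[/measurable_EFinP].
have Ef : \int[mu]_y f y = \int[mu]_y (V y * poisson e x y) - v x * (2 * atan (d / e)).
  rewrite RintegralB//; first by rewrite RintegralZl ?EPI//; exact: iPI.1.
  exact: (integrableZl measurableT _ iPI.1).
have fle : `|\int[mu]_y f y| <= k' * pi + e / 2 * Q.
  have ig : integral_le mu (fun y => k' * (poisson e x \_ I) y +
      e / 2 * (v y ^+ 2 + C * (1 + (x - y) ^+ 2)^-1)) (k' * pi + e / 2 * Q).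
    apply: integral_leD; apply: integral_leZ => //; first exact: ltW.
    by rewrite divr_ge0// ltW.
  apply: integral_le_norm ig _; first exact: mf.
  move=> y; have t0 : 0 <= e / 2 * (v y ^+ 2 + C * (1 + (x - y) ^+ 2)^-1).
    rewrite mulr_ge0 ?divr_ge0 ?(ltW e0)// addr_ge0 ?sqr_ge0//.
    by rewrite mulr_ge0// invr_ge0 addr_ge0// sqr_ge0.
  rewrite /f /V /I !patchE.
  case: ifPn => yn; case: ifPn => yI.
  - have {}hd : `|v y - v x| <= k' by apply: hd; move: yI; rewrite inE/= in_itv.
    rewrite -mulrBl normrM (ger0_norm (P0 y)).
    by have := ler_wpM2r (P0 y) hd; move: t0; lra.
  - rewrite !mulr0 subr0 add0r normrM (ger0_norm (P0 y)).
    apply: poisson_tail => //; rewrite leNgt; apply: contra yI.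
    rewrite ltr_norml inE/= in_itv/=; move: (v y) => ?; clear.
    by move=> /andP[? ?]; apply/andP; split; lra.
  - exfalso; move: yn yI; rewrite notin_setE inE /= !in_itv/= => yn /andP[y1 y2].
    apply: yn; move: n1 n2 y1 y2; clear => *.
    by apply/andP; split; lra.
  - by rewrite !mul0r !mulr0 subr0 normr0 add0r.
have -> : \int[mu]_y (V y * poisson e x y) - pi * v x =
    \int[mu]_y f y - v x * (2 * (pi / 2 - atan (d / e))).
  by rewrite Ef; field.
apply: le_trans (ler_normB _ _) _.
have kp : k' * pi = kappa / 3 by rewrite /k'; move: (@pi R) pi0 => p p0; field; rewrite gt_eqF.
have : `|v x * (2 * (pi / 2 - atan (d / e)))| <= kappa / 3.
  rewrite !normrM (ger0_norm (ler0n _ 2)).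
  have h : `|v x| * m <= kappa / 6.
    rewrite /m mulrA ler_pdivrMr ?mulr_gt0// [leRHS]mulrC.
    have -> : 6 * (`|v x| + 1) * (kappa / 6) = (`|v x| + 1) * kappa by field.
    by rewrite ler_wpM2r ?(ltW k0)//; lra.
  by have := ler_wpM2l (normr_ge0 (v x)) hM; lra.
by move: fle; rewrite kp; lra.
Qed.

End PoissonSmoothing.

(** * Embedding of Sobolev spaces into bounded Lipschitz functions *)
Section SobolevNorm.
Variable R : realType.
Local Notation mu := (@lebesgue_measure R).

Lemma cos_lipschitz (x y : R) : `|cos x - cos y| <= `|x - y|.
Proof.
wlog yx : x y / y <= x => [H|].
  by have [/H//|/ltW/H] := leP y x; rewrite distrC (distrC x).
rewrite [leRHS]ger0_norm ?subr_ge0//.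
apply: (@mean_value_bound R y x (@cos R) (fun t => - sin t) id (cst 1) yx
  (fun t _ => is_derive_cos t) (fun t _ => is_derive_id t 1)).
- by apply: continuous_subspaceT; exact: continuous_cos.
- by apply: continuous_subspaceT => z; exact: cvg_id.
- by move=> t _ /=; rewrite normrN ler_norml sin_geN1 sin_le1.
Qed.

Lemma sin_lipschitz (x y : R) : `|sin x - sin y| <= `|x - y|.
Proof.
wlog yx : x y / y <= x => [H|].
  by have [/H//|/ltW/H] := leP y x; rewrite distrC (distrC x).
rewrite [leRHS]ger0_norm ?subr_ge0//.
apply: (@mean_value_bound R y x (@sin R) (@cos R) id (cst 1) yx
  (fun t _ => is_derive_sin t) (fun t _ => is_derive_id t 1)).
- by apply: continuous_subspaceT; exact: continuous_sin.
- by apply: continuous_subspaceT => z; exact: cvg_id.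
- by move=> t _ /=; rewrite ler_norml cos_geN1 cos_le1.
Qed.

Lemma Lnorm2_cvg0 (f : nat -> R -> R) (eta : R) : 0 < eta ->
  ('N[mu]_2%:E[EFin \o f n] @[n --> \oo] --> 0)%E ->
  \forall n \near \oo, (\int[mu]_x ((f n x) ^+ 2)%:E <= eta%:E)%E.
Proof.
move=> eta0 cvf; have s0 : 0 < Num.sqrt eta by rewrite sqrtr_gt0.
have h0 : \forall n \near \oo, ('N[mu]_2%:E[EFin \o f n] < (Num.sqrt eta)%:E)%E.
  exact: (cvge0_lt cvf s0).
near=> n.
have /ltW h : ('N[mu]_2%:E[EFin \o f n] < (Num.sqrt eta)%:E)%E by near: n.
have n2 : (2 : R) != 0 by rewrite pnatr_eq0.
rewrite [leLHS](_ : _ = \int[mu]_x (`|(EFin \o f n) x| `^ 2))%E; last first.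
  by apply: eq_integral => x _; rewrite /= powR_mulrn// real_normK ?num_real.
rewrite -poweR_Lnorm//.
have -> : eta%:E = ((Num.sqrt eta)%:E `^ 2)%E.
  by rewrite poweR_EFin powR_mulrn ?sqrtr_ge0// sqr_sqrtr// ltW.
apply: gt0_ler_poweR => //; rewrite ?in_itv/= ?leey ?andbT ?Lnorm_ge0 ?lee_fin ?sqrtr_ge0//.
Unshelve. all: by end_near. Qed.

Section OneFunction.
Variables (s r : R) (v a b : R -> R).
Hypotheses (s2 : 2 <= s) (r0 : 0 < r) (cv : continuous v)
  (vab : is_fourier_transform v a b)
  (J : (\int[mu]_xi ((1 + xi ^+ 2) `^ s * (a xi ^+ 2 + b xi ^+ 2))%:E <= (r ^+ 2)%:E)%E).

Let V n := v \_ `[- n%:R, n%:R].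

Let iV n : mu.-integrable setT (EFin \o V n).
Proof.
rewrite /V -restrict_EFin; apply/integrable_restrict => //; rewrite setTI.
by apply: continuous_compact_integrable; [exact: segment_compact|exact: continuous_subspaceT].
Qed.

Let reE n xi : truncated_fourier_re v n xi = cosine_transform (V n) xi.
Proof.
rewrite /truncated_fourier_re /cosine_transform Rintegral_mkcond.
by apply: eq_Rintegral => x _; rewrite /V !patchE; case: ifP => // _; rewrite mul0r.
Qed.

Let imE n xi : truncated_fourier_im v n xi = - sine_transform (V n) xi.
Proof.
rewrite /truncated_fourier_im /sine_transform Rintegral_mkcond; congr (- _).
by apply: eq_Rintegral => x _; rewrite /V !patchE; case: ifP => // _; rewrite mul0r.
Qed.

Let iv2 : mu.-integrable setT (EFin \o (fun y => v y ^+ 2)).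
Proof. by case: vab => h _ _ _ _; exact: Lfun2_integrable_sqr h. Qed.

Let integrable_pairing e n x : 0 < e ->
  mu.-integrable setT (EFin \o (fun xi => abel_weight e xi *
     (cos (x * xi) * cosine_transform (V n) xi + sin (x * xi) * sine_transform (V n) xi))).
Proof.
move=> e0; have [iw _] := abel_weight_integral e0.
have mw : measurable_fun setT (abel_weight e) by case/integrableP : iw => /measurable_EFinP.
pose K := \int[mu]_y `|V n y|.
apply: (integrable_dominated measurableT _ (integrableZl measurableT (K + K) iw)).
  apply: measurable_funM => //; apply: measurable_funD; apply: measurable_funM.
  - by under eq_fun do rewrite mulrC; exact: measurable_cosX.
  - exact: measurable_cosine_transform.
  - by under eq_fun do rewrite mulrC; exact: measurable_sinX.
  - exact: measurable_sine_transform.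
move=> xi _ /=; rewrite normrM mulrC (ger0_norm (abel_weight_ge0 _ e0)).
rewrite ler_wpM2r ?abel_weight_ge0// (le_trans (ler_normD _ _))// lerD// normrM.
  rewrite (@le_trans _ _ `|cosine_transform (V n) xi|)//.
    by rewrite ler_piMl// ler_norml cos_geN1 cos_le1.
  apply: norm_Rintegral_le => //.
  - apply: measurable_funM; last exact: measurable_cosX.
    by case/integrableP : (iV n) => /measurable_EFinP.
  - exact: (integrable_norm (iV n)).
  - by move=> y _; rewrite normrM ler_piMr// ler_norml cos_geN1 cos_le1.
rewrite (@le_trans _ _ `|sine_transform (V n) xi|)//.
  by rewrite ler_piMl// ler_norml sin_geN1 sin_le1.
apply: norm_Rintegral_le => //.
- apply: measurable_funM; last exact: measurable_sinX.
  by case/integrableP : (iV n) => /measurable_EFinP.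
- exact: (integrable_norm (iV n)).
- by move=> y _; rewrite normrM ler_piMr// ler_norml sin_geN1 sin_le1.
Qed.

Let pairing_bound (omega kappa : R) (c d : R -> R) : 0 <= omega -> 0 < kappa ->
  measurable_fun setT c -> measurable_fun setT d ->
  (forall xi, `|c xi| <= 2) -> (forall xi, `|d xi| <= 2) ->
  (forall xi, `|c xi| <= omega * (1 + `|xi|)) ->
  (forall xi, `|d xi| <= omega * (1 + `|xi|)) ->
  forall e, 0 < e -> \forall n \near \oo,
  `|\int[mu]_xi (abel_weight e xi *
      (c xi * cosine_transform (V n) xi + d xi * sine_transform (V n) xi))|
     <= omega * r * (pi + 1) + kappa.
Proof.
move=> om0 k0 mc md c2 d2 co do_ e e0.
case: vab => [_ ha hb cva cvb].
have ma : measurable_fun setT a by move: ha; rewrite inE => /andP[]; rewrite inE.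
have mb : measurable_fun setT b by move: hb; rewrite inE => /andP[]; rewrite inE.
(* With these choices each of the two error terms is kappa / 2. *)
pose theta := e * kappa / 4.
have th0 : 0 < theta by rewrite divr_gt0// mulr_gt0.
pose eta := kappa * theta / 4.
have eta0 : 0 < eta by rewrite divr_gt0// mulr_gt0.
have ha' := Lnorm2_cvg0 eta0 cva.
have hb' := Lnorm2_cvg0 eta0 cvb.
near=> n.
have -> : omega * r * (pi + 1) + kappa = omega * r * (pi + 1) + 2 * theta / e + 2 * eta / theta.
  rewrite /eta /theta; move: (@pi R) => p; field; rewrite !gt_eqF//.
apply: (@fourier_pairing_bound _ s r omega e theta eta a (\- b) _ _ c d) => //.
- exact: ltW.
- exact: measurable_funN.
- exact: measurable_cosine_transform.
- exact: measurable_sine_transform.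
- by under eq_integral do rewrite sqrrN.
- by under eq_integral do rewrite -reE; near: n.
- under eq_integral do rewrite -sqrrN opprB -opprD addrC opprD -imE.
  by near: n.
Unshelve. all: by end_near. Qed.

(** Values and differences of values of v are treated together: a linear
    combination of two values of v corresponds to the same combination of
    exponentials on the Fourier side.  The errors kappa, from the smoothing and
    from the truncation, vanish in the limit. *)
Lemma sobolev_combination_bound (omega : R) (x x' k k' : R) :
  0 <= omega -> `|k| + `|k'| <= 2 ->
  (forall xi, `|k * cos (x * xi) + k' * cos (x' * xi)| <= omega * (1 + `|xi|)) ->
  (forall xi, `|k * sin (x * xi) + k' * sin (x' * xi)| <= omega * (1 + `|xi|)) ->
  `|k * v x + k' * v x'| <= 2 * omega * r.
Proof.
move=> om0 kk hc hs.
have p2 := @pi_ge2 R.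
have kk0 : `|k| <= 2 /\ `|k'| <= 2 by have := normr_ge0 k; have := normr_ge0 k'; lra.
suff : pi * `|k * v x + k' * v x'| <= omega * r * (pi + 1).
  have h0 : 0 <= omega * r by rewrite mulr_ge0// ltW.
  have p0 : 0 < pi :> R by lra.
  move=> H; rewrite -(ler_pM2l p0); apply: le_trans H _.
  by have := ler_wpM2l h0 p2; lra.
apply/ler_addgt0Pr => eps eps0.
pose kappa := eps / 3; have kappa0 : 0 < kappa by rewrite divr_gt0.
have [d1 d10 h1] := poisson_limit x cv iv2 kappa0.
have [d2 d20 h2] := poisson_limit x' cv iv2 kappa0.
(* The same e serves both points, and later the same n. *)
pose e := Num.min d1 d2 / 2.
have e0 : 0 < e by rewrite divr_gt0// lt_min d10.
have em : e < Num.min d1 d2.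
  by rewrite /e ltr_pdivrMr// ltr_pMr ?lt_min ?d10// ltr1n.
move: em; rewrite lt_min => /andP[ed1 ed2].
have [n1 {}h1] := h1 e (introT andP (conj e0 ed1)).
have [n2 {}h2] := h2 e (introT andP (conj e0 ed2)).
have mcos (z : R) : measurable_fun setT (fun xi : R => cos (z * xi)).
  by under eq_fun do rewrite mulrC; exact: measurable_cosX.
have msin (z : R) : measurable_fun setT (fun xi : R => sin (z * xi)).
  by under eq_fun do rewrite mulrC; exact: measurable_sinX.
have b2 (p q : R) : `|p| <= 1 -> `|q| <= 1 -> `|k * p + k' * q| <= 2.
  move=> p1 q1; apply: le_trans kk; rewrite (le_trans (ler_normD _ _))//.
  by rewrite !normrM lerD// ler_piMr.
have [n3 _ h3] : \forall n \near \oo, `|\int[mu]_xi (abel_weight e xi *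
    ((k * cos (x * xi) + k' * cos (x' * xi)) * cosine_transform (V n) xi +
     (k * sin (x * xi) + k' * sin (x' * xi)) * sine_transform (V n) xi))|
     <= omega * r * (pi + 1) + kappa.
  apply: pairing_bound => //.
  - by apply: measurable_funD; apply: measurable_funM.
  - by apply: measurable_funD; apply: measurable_funM.
  - by move=> xi; rewrite b2// ler_norml cos_geN1 cos_le1.
  - by move=> xi; rewrite b2// ler_norml sin_geN1 sin_le1.
pose n := maxn n1 (maxn n2 n3).
have {}h1 := h1 n (leq_maxl _ _).
have {}h2 := h2 n (leq_trans (leq_maxl _ _) (leq_maxr _ _)).
have {}h3 := h3 n (leq_trans (leq_maxr _ _) (leq_maxr _ _)).
rewrite (poisson_integral (iV n) x e0) in h1.
rewrite (poisson_integral (iV n) x' e0) in h2.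
set L := (X in `|X - _| <= _) in h1; set L' := (X in `|X - _| <= _) in h2.
have E : k * L + k' * L' = \int[mu]_xi (abel_weight e xi *
    ((k * cos (x * xi) + k' * cos (x' * xi)) * cosine_transform (V n) xi +
     (k * sin (x * xi) + k' * sin (x' * xi)) * sine_transform (V n) xi)).
  rewrite /L /L' -!RintegralZl//; try exact: integrable_pairing.
  rewrite -RintegralD//; last 2 first.
    exact: (integrableZl measurableT k (integrable_pairing n x e0)).
    exact: (integrableZl measurableT k' (integrable_pairing n x' e0)).
  by apply: eq_Rintegral => xi _ /=; ring.
rewrite -E in h3.
have p0 : 0 <= pi :> R by lra.
rewrite -(ger0_norm p0) -normrM (ger0_norm p0).
have -> : pi * (k * v x + k' * v x') =
  (k * L + k' * L') - (k * (L - pi * v x) + k' * (L' - pi * v x')) by ring.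
apply: le_trans (ler_normB _ _) _.
have h4 : `|k * (L - pi * v x) + k' * (L' - pi * v x')| <= 2 * kappa.
  rewrite (le_trans (ler_normD _ _))// !normrM.
  have := ler_wpM2l (normr_ge0 k) h1; have := ler_wpM2l (normr_ge0 k') h2.
  by have := ler_wpM2r (ltW kappa0) kk; lra.
have : kappa * 3 = eps by rewrite /kappa; field.
by move: h3 h4; lra.
Qed.

Lemma sobolev_bound : (forall x, `|v x| <= 2 * r) /\
  (forall x y, `|v x - v y| <= 2 * r * `|x - y|).
Proof.
split=> [x|x y].
- have := @sobolev_combination_bound 1 x x 1 0 ler01.
  rewrite normr1 normr0 addr0 mul1r mul0r addr0 mulr1.
  apply; first by rewrite ler1n.
  + move=> xi; rewrite !mul1r mul0r addr0.
    have h : `|cos (x * xi)| <= 1 by rewrite ler_norml cos_geN1 cos_le1.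
    by have := normr_ge0 xi; lra.
  + move=> xi; rewrite !mul1r mul0r addr0.
    have h : `|sin (x * xi)| <= 1 by rewrite ler_norml sin_geN1 sin_le1.
    by have := normr_ge0 xi; lra.
- have := @sobolev_combination_bound `|x - y| x y 1 (-1) (normr_ge0 _).
  rewrite normrN normr1 mul1r mulN1r mulrAC; apply.
  + lra.
  + move=> xi; rewrite mul1r mulN1r (le_trans (cos_lipschitz _ _))//.
    by rewrite -mulrBl normrM ler_wpM2l// lerDr.
  + move=> xi; rewrite mul1r mulN1r (le_trans (sin_lipschitz _ _))//.
    by rewrite -mulrBl normrM ler_wpM2l// lerDr.
Qed.

End OneFunction.

Lemma sobolev_embedding (s r : R) (v : R -> R) : 2 <= s -> continuous v ->
  (sobolev_norm s v < r%:E)%E ->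
  (forall x, `|v x| <= 2 * r) /\ (forall x y, `|v x - v y| <= 2 * r * `|x - y|).
Proof.
move=> s2 cv /ereal_inf_lt[_ [a [b [vab ->]]]].
set J := (\int[_]_xi _)%E => hJ.
have J0 : (0 <= J)%E.
  apply: integral_ge0 => xi _; rewrite lee_fin mulr_ge0 ?powR_ge0//.
  by rewrite addr_ge0// sqr_ge0.
have r0 : 0 < r by rewrite -lte_fin (le_lt_trans _ hJ)// sqrte_ge0.
apply: (sobolev_bound s2 r0 cv vab).
rewrite -/J; move: J J0 hJ => [j| |]//=; rewrite !lee_fin => j0 hj.
rewrite -[leLHS]sqr_sqrtr//; rewrite lte_fin in hj.
by rewrite lerXn2r ?nnegrE ?sqrtr_ge0 ?ltW.
Qed.

End SobolevNorm.

(** * Series over the integers *)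
Section ZSeries.
Variable R : realType.
Implicit Types (a b : int -> R) (M : R).

(** Since Negz k is - (k + 1), this sums a over the range - n <= j < n. *)
Definition zpartial a (n : nat) : R := \sum_(0 <= k < n) (a (Posz k) + a (Negz k)).

Definition zsummable_le a M := forall n, zpartial (fun j => `|a j|) n <= M.

Lemma zpartialS a n : zpartial a n.+1 = zpartial a n + (a (Posz n) + a (Negz n)).
Proof. by rewrite /zpartial big_nat_recr. Qed.

Lemma zpartial0 a : zpartial a 0 = 0.
Proof. by rewrite /zpartial big_geq. Qed.

Lemma zsummable_le_cvg a M : zsummable_le a M ->
  cvgn (series (fun n : nat => a (Posz n))) /\ cvgn (series (fun n : nat => a (Negz n))).
Proof.
move=> h.
have key (c : nat -> R) : (forall n, \sum_(0 <= k < n) `|c k| <= M) -> cvgn (series c).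
  move=> hc; have : cvgn (series (fun k => `|c k|)).
    apply: nondecreasing_is_cvgn.
      by apply/nondecreasing_seqP => n; rewrite !seriesEnat/= big_nat_recr//= lerDl.
    by exists M => _ [n _ <-]; rewrite seriesEnat/=; exact: hc.
  exact: normed_cvg.
by split; apply: key => n; apply: le_trans (h n); apply: ler_sum => k _;
  rewrite ?lerDl ?lerDr.
Qed.

Lemma zpartial_cvg a M : zsummable_le a M -> zpartial a n @[n --> \oo] --> zseries a.
Proof.
move=> /zsummable_le_cvg[c1 c2]; rewrite /zseries.
rewrite (_ : zpartial a =
    series (fun n : nat => a (Posz n)) \+ series (fun n : nat => a (Negz n))).
  exact: cvgD.
by apply/funext => n; rewrite /zpartial /= !seriesEnat /= big_split.
Qed.

Lemma zseries_eq a M (l : R) : zsummable_le a M ->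
  zpartial a n @[n --> \oo] --> l -> zseries a = l.
Proof. by move=> /zpartial_cvg h h'; exact: (cvg_unique _ h h'). Qed.

Lemma zseries_le a M : zsummable_le a M -> `|zseries a| <= M.
Proof.
move=> h.
have hc : `|zpartial a n| @[n --> \oo] --> `|zseries a|.
  exact: (cvg_norm (zpartial_cvg h)).
rewrite -(cvg_lim _ hc)//; apply: limr_le; first by apply/cvg_ex; exists `|zseries a|.
near=> n; apply: le_trans (h n).
apply: le_trans (ler_norm_sum _ _ _) _; apply: ler_sum => k _.
exact: ler_normD.
Unshelve. all: by end_near. Qed.

Lemma zsummable_leW a b M : (forall j, `|a j| <= b j) ->
  (forall n, zpartial b n <= M) -> zsummable_le a M.
Proof.
by move=> ab hb n; apply: le_trans (hb n); apply: ler_sum => k _; rewrite lerD.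
Qed.

Lemma zsummable_leB a b M N : zsummable_le a M -> zsummable_le b N ->
  zsummable_le (fun j => a j - b j) (M + N).
Proof.
move=> ha hb n; apply: le_trans (lerD (ha n) (hb n)).
rewrite /zpartial -big_split/=; apply: ler_sum => k _.
rewrite addrACA; apply: lerD; exact: ler_normB.
Qed.

Lemma zsummable_leZ (c : R) a M : zsummable_le a M ->
  zsummable_le (fun j => c * a j) (`|c| * M).
Proof.
move=> ha n; apply: le_trans (ler_wpM2l (normr_ge0 c) (ha n)).
by rewrite /zpartial big_distrr; apply: ler_sum => k _; rewrite /= !normrM mulrDr.
Qed.

Lemma zseriesB a b M N : zsummable_le a M -> zsummable_le b N ->
  zseries (fun j => a j - b j) = zseries a - zseries b.
Proof.
move=> ha hb; apply: (zseries_eq (zsummable_leB ha hb)).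
rewrite (_ : zpartial _ = fun n => zpartial a n - zpartial b n).
  by apply: cvgB; [exact: zpartial_cvg ha|exact: zpartial_cvg hb].
apply/funext => n; rewrite /zpartial -sumrB; apply: eq_bigr => k _; ring.
Qed.

Lemma zseriesZ (c : R) a M : zsummable_le a M ->
  zseries (fun j => c * a j) = c * zseries a.
Proof.
move=> ha; apply: (zseries_eq (zsummable_leZ c ha)).
rewrite (_ : zpartial _ = fun n => c * zpartial a n).
  by apply: cvgM; [exact: cvg_cst|exact: zpartial_cvg ha].
by apply/funext => n; rewrite /zpartial big_distrr; apply: eq_bigr => k _; rewrite /= mulrDr.
Qed.

Lemma zpartial_telescope (Psi : int -> R) (i : int) (n : nat) :
  zpartial (fun j => Psi (i - j) - Psi (i - j - 1)) n = Psi (i + n%:Z) - Psi (i - n%:Z).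
Proof.
elim: n => [|n IH]; first by rewrite zpartial0 oppr0 subrr.
rewrite zpartialS IH NegzE !opprK.
have -> : i - n%:Z - 1 = i - n.+1%:Z by lia.
have -> : i + n.+1%:Z - 1 = i + n%:Z by lia.
ring.
Qed.

End ZSeries.

(** * Stability of the semidiscrete operator *)
Section Semidiscrete.
Variable R : realType.
Variables (beta Vr : R -> R) (B h : R).
Hypotheses (h0 : 0 < h) (Vr0 : forall x, 0 <= Vr x <= B)
  (betaV : forall x y, x <= y -> `|beta y - beta x| <= Vr y - Vr x).

(** These are the weights of the centered difference of the discrete
    convolution: the mesh size h in the convolution cancels the one in the
    difference. *)
Definition difference_kernel (i j : int) : R :=
  (beta ((i + 1 - j)%:~R * h) - beta ((i - 1 - j)%:~R * h)) / 2.

Let Vg (k : int) := Vr (k%:~R * h).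

(** An interval of length 2 h is the union of two cells, so the weights are
    dominated by the increments of Vr over two interlaced partitions of the
    line; both families of increments telescope. *)
Lemma difference_kernel_summable (i : int) (w : int -> R) (K : R) :
  (forall j, `|w j| <= K) -> zsummable_le (fun j => difference_kernel i j * w j) (B * K).
Proof.
move=> wK; have K0 : 0 <= K by exact: le_trans (normr_ge0 _) (wK 0).
pose b1 := fun j : int => Vg (i + 1 - j) - Vg (i + 1 - j - 1).
pose b2 := fun j : int => Vg (i - j) - Vg (i - j - 1).
apply: (@zsummable_leW _ _ (fun j => K / 2 * (b1 j + b2 j))).
  move=> j; rewrite normrM /difference_kernel normrM (ger0_norm (_ : 0 <= 2^-1 :> R)) ?invr_ge0//.
  have e1 : (i - 1 - j)%:~R * h <= (i + 1 - j)%:~R * h :> R.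
    by rewrite ler_wpM2r ?(ltW h0)// ler_int; lia.
  have hb := betaV e1.
  apply: (@le_trans _ _ ((Vr ((i + 1 - j)%:~R * h) - Vr ((i - 1 - j)%:~R * h)) / 2 * K)).
    by apply: ler_pM => //; rewrite ?mulr_ge0 ?invr_ge0// ler_wpM2r// invr_ge0.
  rewrite /b1 /b2 /Vg.
  have -> : i + 1 - j - 1 = i - j by lia.
  have -> : i - j - 1 = i - 1 - j by lia.
  by lra.
move=> n.
have -> : zpartial (fun j => K / 2 * (b1 j + b2 j)) n = K / 2 * (zpartial b1 n + zpartial b2 n).
  rewrite /zpartial -big_split/= big_distrr; apply: eq_bigr => k _ /=; ring.
rewrite !zpartial_telescope.
have := Vr0 ((i + 1 + n%:Z)%:~R * h); have := Vr0 ((i + 1 - n%:Z)%:~R * h).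
have := Vr0 ((i + n%:Z)%:~R * h); have := Vr0 ((i - n%:Z)%:~R * h).
rewrite -!/(Vg _) => /andP[a1 a2] /andP[a3 a4] /andP[a5 a6] /andP[a7 a8].
have : Vg (i + 1 + n%:Z) - Vg (i + 1 - n%:Z) + (Vg (i + n%:Z) - Vg (i - n%:Z)) <= 2 * B by lra.
by move=> /(ler_wpM2l (divr_ge0 K0 (ler0n R 2))); lra.
Qed.

Hypothesis beta_sum : forall i : int, exists M : R, zsummable_le (fun j => beta ((i - j)%:~R * h)) M.

(** Summability of the samples of beta is what allows the difference of the two
    series to be taken term by term. *)
Lemma semidiscrete_rhsE (f : R -> R) (v : int -> R) (K : R) (i : int) :
  (forall j, `|f (v j)| <= K) ->
  semidiscrete_rhs beta f h v i = - zseries (fun j => difference_kernel i j * f (v j)).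
Proof.
move=> fK; rewrite /semidiscrete_rhs /centered_difference /discrete_convolution /grid.
have K0 : 0 <= K by exact: le_trans (normr_ge0 _) (fK 0).
have S (k : int) : exists M : R, zsummable_le (fun j => h * beta ((k - j)%:~R * h) * (f \o v) j) M.
  have [M hM] := beta_sum k; exists (h * K * M) => n.
  have := ler_wpM2l (mulr_ge0 (ltW h0) K0) (hM n); apply: le_trans.
  rewrite /zpartial big_distrr; apply: ler_sum => j _.
  rewrite /= mulrDr; apply: lerD;
    by rewrite !normrM (ger0_norm (ltW h0)) -mulrA -[leRHS]mulrA
      ler_wpM2l ?(ltW h0)// mulrC ler_wpM2r.
have [M1 S1] := S (i + 1); have [M2 S2] := S (i - 1).
rewrite -(zseriesB S1 S2) [X in - X]mulrC.
rewrite -(zseriesZ _ (zsummable_leB S1 S2)); congr (- _); congr zseries.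
apply/funext => j /=; rewrite /difference_kernel; field.
by rewrite gt_eqF.
Qed.

Lemma semidiscrete_rhs_bound (f : R -> R) (v : int -> R) (K : R) (i : int) :
  (forall j, `|f (v j)| <= K) -> `|semidiscrete_rhs beta f h v i| <= B * K.
Proof.
move=> fK; rewrite (semidiscrete_rhsE _ fK) normrN; apply: zseries_le.
exact: difference_kernel_summable.
Qed.

Lemma semidiscrete_rhs_lipschitz (f : R -> R) (v w : int -> R) (Kv Kw L : R) (i : int) :
  (forall j, `|f (v j)| <= Kv) -> (forall j, `|f (w j)| <= Kw) ->
  (forall j, `|f (v j) - f (w j)| <= L) ->
  `|semidiscrete_rhs beta f h v i - semidiscrete_rhs beta f h w i| <= B * L.
Proof.
move=> fv fw fL; rewrite (semidiscrete_rhsE _ fv) (semidiscrete_rhsE _ fw).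
rewrite -opprD normrN.
rewrite -(zseriesB (difference_kernel_summable i fv) (difference_kernel_summable i fw)).
apply: zseries_le.
rewrite (_ : (fun j => _) = (fun j => difference_kernel i j * (f (v j) - f (w j)))).
  exact: difference_kernel_summable.
by apply/funext => j; rewrite mulrBr.
Qed.

End Semidiscrete.

(** * Increments of convolutions with distribution functions *)
Section FiniteMeasureOnLine.
Variable R : realType.
Local Notation mu := (@lebesgue_measure R).
Variable m : {finite_measure set (measurableTypeR R) -> \bar R}.

Definition distribution_function (z : R) : R := fine (m `]-oo, z]%classic).
Local Notation F := distribution_function.

Definition total_mass : R := fine (m setT).
Local Notation B := total_mass.

Lemma total_massE : m setT = B%:E.
Proof. by rewrite /total_mass fineK// fin_num_measure. Qed.

Lemma total_mass_ge0 : 0 <= B.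
Proof. by rewrite fine_ge0. Qed.

Lemma Rintegral_indic (A : set (measurableTypeR R)) : measurable A ->
  \int[m]_w \1_A w = fine (m A).
Proof. by move=> mA; rewrite /Rintegral integral_indic// setIT. Qed.

Lemma distribution_functionB (x y : R) : x <= y ->
  F y - F x = fine (m `]x, y]%classic).
Proof.
move=> xy; apply/eqP; rewrite subr_eq addrC; apply/eqP.
rewrite /F -fineD ?fin_num_measure// -measureU//.
  by rewrite -itv_bndbnd_setU.
apply/seteqP; split => // z /= []; rewrite !in_itv/= => zx /andP[].
by rewrite ltNge zx.
Qed.

Lemma distribution_function_bounds (z : R) : 0 <= F z <= B.
Proof.
rewrite fine_ge0//= -lee_fin /F /B !fineK ?fin_num_measure//.
by apply: le_measure; rewrite ?inE.
Qed.

Lemma distribution_function_le (x y : R) : x <= y -> F x <= F y.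
Proof. by move=> xy; rewrite -subr_ge0 distribution_functionB// fine_ge0. Qed.

Lemma finite_measure_bounded_integrable (f : R -> R) (K : R) :
  measurable_fun setT f -> (forall x, `|f x| <= K) ->
  m.-integrable setT (EFin \o f) /\ `|\int[m]_x f x| <= K * B.
Proof.
move=> mf fK.
have iK : m.-integrable setT (EFin \o cst K).
  exact: finite_measure_integrable_cst.
split.
  by apply: (integrable_dominated measurableT _ iK) => // x _; exact: fK.
apply: (@le_trans _ _ (\int[m]_x cst K x)).
  by apply: norm_Rintegral_le => // x _; exact: fK.
by rewrite Rintegral_cst.
Qed.

Section Increment.
Variables (g : R -> R) (K L x eta : R).
Hypotheses (mg : measurable_fun setT g) (gK : forall y, `|g y| <= K)
  (gL : forall y z, `|g y - g z| <= L * `|y - z|) (eta0 : 0 < eta).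

Let phi (z : R) : R := \1_(`]x, x + eta]%classic) z.

Let mphi : measurable_fun setT phi.
Proof. exact: measurable_indic. Qed.

Let phi01 z : 0 <= phi z <= 1.
Proof. by rewrite /phi indicE; case: (_ \in _) => /=; rewrite lexx ler01. Qed.

Let phiE (y : R) : (fun w => phi (y + w)) = \1_(`]x - y, x + eta - y]%classic).
Proof.
apply/funext => w; rewrite /phi !indicE; congr (_%:R); congr nat_of_bool.
apply/idP/idP; rewrite !inE/= !in_itv/= => /andP[? ?]; by apply/andP; split; lra.
Qed.

Let phi_m (y : R) : \int[m]_w phi (y + w) = F (x + eta - y) - F (x - y).
Proof.
rewrite phiE Rintegral_indic; last exact: measurable_itv.
by rewrite distribution_functionB// lerD2r lerDl ltW.
Qed.

Let phi_mu (w : R) : (\int[mu]_y (phi (y + w))%:E = eta%:E)%E.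
Proof.
rewrite (_ : (fun y => (phi (y + w))%:E) = EFin \o \1_(`]x - w, x + eta - w]%classic)); last first.
  by rewrite -phiE; apply/funext => y /=; rewrite addrC.
rewrite integral_indic// setIT /= lebesgue_measure_itv/= lte_fin ifT; last by rewrite ltrD2r ltrDl.
by rewrite -EFinD; congr EFin; lra.
Qed.

Let iphi (w : R) : mu.-integrable setT (EFin \o (fun y => phi (y + w))).
Proof.
apply/integrableP; split.
  apply/measurable_EFinP; apply: measurableT_comp => //.
  by apply: measurable_funD.
under eq_integral => y _ do rewrite gee0_abs ?lee_fin ?(andP (phi01 _)).1//.
by rewrite phi_mu ltry.
Qed.

Let f (p : measurableTypeR R * measurableTypeR R) : R := g p.1 * phi (p.1 + p.2).

Let mf : measurable_fun setT f.
Proof.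
apply: measurable_funM; first exact: (measurableT_comp mg measurable_fst).
apply: (measurableT_comp mphi).
by apply: measurable_funD; [exact: measurable_fst|exact: measurable_snd].
Qed.

Let K0 : 0 <= K. Proof. exact: le_trans (normr_ge0 _) (gK 0). Qed.

Let if_ : (mu \x m)%E.-integrable setT (EFin \o f).
Proof.
apply/integrable21ltyP; first exact/measurable_EFinP.
apply: (@le_lt_trans _ _ (\int[m]_w (K * eta)%:E)%E); last first.
  by rewrite integral_cst// [X in (_ * X)%E](_ : _ = B%:E) -?EFinM ?ltry//; exact: total_massE.
apply: ge0_le_integral => //=.
- by move=> w _; exact: integral_ge0.
- apply: (measurable_fun_fubini_tonelli_G (fun p => `|(f p)%:E|)%E) => //.
  by apply/measurable_EFinP; exact: measurableT_comp.
- move=> w _; rewrite EFinM -(phi_mu w) -ge0_integralZl//=; first last.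
  + by move=> y _; rewrite lee_fin (andP (phi01 _)).1.
  + by case/integrableP : (iphi w).
  apply: ge0_le_integral => //=.
  + apply/measurable_EFinP; apply: measurableT_comp => //.
    exact: (measurableT_comp mf (@measurable_pair2 _ _ _ _ w)).
  + by apply: emeasurable_funM => //; case/integrableP : (iphi w).
  + move=> y _; rewrite -EFinM lee_fin /f /= normrM.
    by rewrite (ger0_norm (andP (phi01 _)).1) ler_wpM2r// (andP (phi01 _)).1.
Qed.

Let imf (y : R) : m.-integrable setT (fun w => (f (y, w))%:E).
Proof.
have mfy : measurable_fun setT (fun w => f (y, w)).
  exact: (measurableT_comp mf (@measurable_pair1 _ _ _ _ y)).
have fyK w : `|f (y, w)| <= K.
  rewrite /f/= normrM (ger0_norm (andP (phi01 _)).1).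
  by rewrite -[leRHS]mulr1; apply: ler_pM => //; case/andP: (phi01 (y + w)).
exact: (finite_measure_bounded_integrable mfy fyK).1.
Qed.

Let imuf (w : R) : mu.-integrable setT (fun y => (f (y, w))%:E).
Proof.
have mfw : measurable_fun setT (fun y => f (y, w)).
  exact: (measurableT_comp mf (@measurable_pair2 _ _ _ _ w)).
apply: (integrable_dominated measurableT mfw (integrableZl measurableT K (iphi w))).
move=> y _; rewrite /f/= normrM (ger0_norm (andP (phi01 _)).1).
by rewrite ler_wpM2r// (andP (phi01 _)).1.
Qed.

Let mphiy (y : R) : m.-integrable setT (EFin \o (fun w => phi (y + w))).
Proof.
have mfy : measurable_fun setT (fun w => phi (y + w)).
  by apply: measurableT_comp => //; apply: measurable_funD.
have fyK w : `|phi (y + w)| <= 1.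
  by case/andP: (phi01 (y + w)) => ? ?; rewrite ger0_norm.
exact: (finite_measure_bounded_integrable mfy fyK).1.
Qed.

Let inner (y : R) : \int[m]_w f (y, w) = g y * (F (x + eta - y) - F (x - y)).
Proof. by rewrite /f /= RintegralZl// phi_m. Qed.

Lemma integrable_increment :
  mu.-integrable setT (EFin \o (fun y => g y * (F (x + eta - y) - F (x - y)))).
Proof.
have := integrable_fubini_F if_; apply: eq_integrable => // y _.
by rewrite /= -inner /Rintegral fineK//; exact: integrable_fin_num.
Qed.

(** By Fubini's theorem, the first integral is the integral over w, against m,
    of the integral of g over an interval of length eta with end point x - w. *)
Lemma increment_estimate :
  `|\int[mu]_y (g y * (F (x + eta - y) - F (x - y))) - eta * \int[m]_w g (x - w)|
   <= L * eta ^+ 2 * B.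
Proof.
under eq_Rintegral do rewrite -inner.
rewrite (Rintegral_Fubini if_ imf imuf).
have mgx : measurable_fun setT (fun w : R => g (x - w)).
  by apply: measurableT_comp => //; apply: measurable_funB.
have igx : m.-integrable setT (EFin \o (fun w => g (x - w))).
  by apply: (finite_measure_bounded_integrable (K := K) _ _).1 => // w; exact: gK.
have mH : measurable_fun setT (fun w : R => \int[mu]_y f (y, w)).
  exact: measurable_Rintegral_param if_.
have HE (w : R) : `|\int[mu]_y f (y, w) - eta * g (x - w)| <= L * eta ^+ 2.
  have Ephi : \int[mu]_y phi (y + w) = eta by rewrite /Rintegral phi_mu.
  have -> : \int[mu]_y f (y, w) - eta * g (x - w) =
      \int[mu]_y ((g y - g (x - w)) * phi (y + w)).
    have i1 : mu.-integrable setT (EFin \o (fun y => f (y, w))) := imuf w.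
    have i2 : mu.-integrable setT (EFin \o (fun y => g (x - w) * phi (y + w))).
      exact: (integrableZl measurableT (g (x - w)) (iphi w)).
    have -> : eta * g (x - w) = \int[mu]_y (g (x - w) * phi (y + w)).
      by rewrite RintegralZl// Ephi mulrC.
    rewrite -RintegralB//.
    by apply: eq_Rintegral => y _; rewrite /f/= mulrBl.
  have -> : L * eta ^+ 2 = \int[mu]_y (L * eta * phi (y + w)).
    by rewrite RintegralZl// Ephi expr2 mulrA.
  apply: norm_Rintegral_le => //.
  - apply: measurable_funM; first by apply: measurable_funB.
    by case/integrableP : (iphi w) => /measurable_EFinP.
  - exact: (integrableZl measurableT _ (iphi w)).
  - move=> y _; rewrite normrM (ger0_norm (andP (phi01 _)).1).
    rewrite {1 2}/phi indicE; have [|_] := boolP (_ \in _); last by rewrite !mulr0.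
    rewrite inE/= in_itv/= !mulr1 => /andP[h1 h2].
    apply: le_trans (gL _ _) _; have L0 : 0 <= L.
      have := gL 1 0; rewrite subr0 normr1 mulr1; exact: le_trans.
    by rewrite ler_wpM2l// ger0_norm; lra.
have mHg : measurable_fun setT (fun w : R => \int[mu]_y f (y, w) - eta * g (x - w)).
  by apply: measurable_funB => //; apply: measurable_funM.
have iH : m.-integrable setT (EFin \o (fun w => \int[mu]_y f (y, w))).
  apply: (finite_measure_bounded_integrable (K := K * eta) _ _).1; first exact: mH.
  move=> w.
  have Ephi : \int[mu]_y phi (y + w) = eta by rewrite /Rintegral phi_mu.
  rewrite -Ephi -RintegralZl//; apply: norm_Rintegral_le => //.
  - exact: (measurableT_comp mf (@measurable_pair2 _ _ _ _ w)).
  - exact: (integrableZl measurableT _ (iphi w)).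
  - move=> y _; rewrite /f/= normrM (ger0_norm (andP (phi01 _)).1).
    by rewrite ler_wpM2r// (andP (phi01 _)).1.
rewrite -RintegralZl// -RintegralB//; last exact: (integrableZl measurableT _ igx).
by apply: (finite_measure_bounded_integrable _ _).2; [exact: mHg|exact: HE].
Qed.

End Increment.

End FiniteMeasureOnLine.

(** * Riemann sums for a finite measure *)
Section RiemannSums.
Variable R : realType.
Local Notation mu := (@lebesgue_measure R).

Section FiniteMeasure.
Variable m : {finite_measure set (measurableTypeR R) -> \bar R}.
Local Notation F := (distribution_function m).
Local Notation B := (total_mass m).
Variable h : R.
Hypothesis h0 : 0 < h.

Let Fg (k : int) := F (k%:~R * h).

Let cut (i : int) (n : nat) : (i - n%:Z)%:~R * h <= (i + n%:Z)%:~R * h.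
Proof. by rewrite ler_wpM2r ?(ltW h0)// ler_int; lia. Qed.

Let grid_escape (i : int) (z : R) : exists n : nat, (i - n%:Z)%:~R * h < z <= (i + n%:Z)%:~R * h.
Proof.
pose n := (Num.truncn (`|z / h| + `|i%:~R|)).+1.
exists n; have hn : `|z / h| + `|i%:~R| < n%:R by rewrite /n truncnS_gt.
have := ler_norm (z / h); have := ler_norm (- (z / h)); have := ler_norm (i%:~R : R).
have := ler_norm (- i%:~R : R); rewrite !normrN intrB intrD -!pmulrn => *.
rewrite -ltr_pdivlMr// -ler_pdivrMr//; apply/andP; split; lra.
Qed.

Lemma grid_mass_cvg (i : int) : Fg (i + n%:Z) - Fg (i - n%:Z) @[n --> \oo] --> B.
Proof.
pose A (n : nat) : set (measurableTypeR R) := `](i - n%:Z)%:~R * h, (i + n%:Z)%:~R * h]%classic.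
rewrite (_ : (fun n : nat => _) = fun n => fine (m (A n))); last first.
  by apply/funext => n; rewrite /Fg distribution_functionB.
apply: fine_cvg; rewrite /total_mass fineK ?fin_num_measure//.
have -> : [set: measurableTypeR R] = \bigcup_n A n.
  apply/seteqP; split => // z _; have [n hz] := grid_escape i z.
  by exists n => //=; rewrite /A/= in_itv.
apply: nondecreasing_cvg_mu.
- by move=> n; exact: measurable_itv.
- by apply: bigcupT_measurable => n; exact: measurable_itv.
- move=> p q pq; apply/subsetPset; apply: subset_itv; rewrite bnd_simp.
    by rewrite ler_wpM2r ?(ltW h0)// ler_int; lia.
  by rewrite ler_wpM2r ?(ltW h0)// ler_int; lia.
Qed.

(** No mass is lost in cutting the line into cells (grid_mass_cvg), so the
    integral is the sum of its parts over the cells, where G is close to a j. *)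
Lemma riemann_sum_estimate (G : R -> R) (K eps : R) (i : int) (a : int -> R) :
  measurable_fun setT G -> (forall w, `|G w| <= K) -> (forall j, `|a j| <= K) ->
  (forall (j : int) (w : R), (i - j - 1)%:~R * h < w <= (i - j)%:~R * h ->
     `|G w - a j| <= eps) ->
  zsummable_le (fun j => (Fg (i - j) - Fg (i - j - 1)) * a j) (K * B) /\
  `|\int[m]_w G w - zseries (fun j => (Fg (i - j) - Fg (i - j - 1)) * a j)| <= eps * B.
Proof.
move=> mG GK aK Ga; have K0 : 0 <= K by exact: le_trans (normr_ge0 _) (GK 0).
have iG : m.-integrable setT (EFin \o G).
  by have [] := @finite_measure_bounded_integrable R m G K mG GK.
pose C j : set (measurableTypeR R) := `](i - j - 1)%:~R * h, (i - j)%:~R * h]%classic.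
have Cle (j : int) : (i - j - 1)%:~R * h <= (i - j)%:~R * h :> R.
  by rewrite ler_wpM2r ?(ltW h0)// ler_int; lia.
have mC j : fine (m (C j)) = Fg (i - j) - Fg (i - j - 1) by rewrite /Fg distribution_functionB.
have FgB (k : int) : 0 <= Fg k <= B by exact: distribution_function_bounds.
have tel (c : R) : 0 <= c -> forall n,
    zpartial (fun j => c * (Fg (i - j) - Fg (i - j - 1))) n <= c * B.
  move=> c0 n.
  have -> : zpartial (fun j => c * (Fg (i - j) - Fg (i - j - 1))) n =
      c * zpartial (fun j => Fg (i - j) - Fg (i - j - 1)) n.
    by rewrite /zpartial big_distrr; apply: eq_bigr => k _; rewrite /= -mulrDr.
  rewrite zpartial_telescope ler_wpM2l//.
  by have := FgB (i + n%:Z); have := FgB (i - n%:Z) => /andP[? ?] /andP[? ?]; lra.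
have Fdiff j : 0 <= Fg (i - j) - Fg (i - j - 1) by rewrite -mC fine_ge0.
have sa : zsummable_le (fun j => (Fg (i - j) - Fg (i - j - 1)) * a j) (K * B).
  apply: zsummable_leW (tel K K0) => j.
  by rewrite normrM ger0_norm// mulrC ler_wpM2r.
split => //.
pose c j := \int[m]_(w in C j) G w.
have iGC j : m.-integrable (C j) (EFin \o G).
  by apply: integrableS iG => //; exact: measurable_itv.
have cst_int j (k : R) : m.-integrable (C j) (EFin \o cst k).
  by apply: finite_measure_integrable_cst; exact: measurable_itv.
have cK j : `|c j| <= K * (Fg (i - j) - Fg (i - j - 1)).
  apply: (@le_trans _ _ (\int[m]_(w in C j) cst K w)).
    apply: norm_Rintegral_le; [exact: measurable_itv|exact: measurable_funTS| |].
      exact: cst_int.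
    by move=> w _; exact: GK.
  by rewrite Rintegral_cst ?mC//; exact: measurable_itv.
have sc : zsummable_le c (K * B) by apply: zsummable_leW (tel K K0).
pose Psi (k : int) := \int[m]_(w in `]-oo, k%:~R * h]) G w.
have PsiE (k l : int) : k%:~R * h <= l%:~R * h :> R ->
    Psi l - Psi k = \int[m]_(w in `]k%:~R * h, l%:~R * h]) G w.
  move=> kl; apply/eqP; rewrite subr_eq addrC; apply/eqP.
  rewrite /Psi -Rintegral_setU//.
  - by rewrite -itv_bndbnd_setU.
  - rewrite -itv_bndbnd_setU//; apply: integrableS iG => //; exact: measurable_itv.
  - apply/disj_setPS => z /= []; rewrite !in_itv/= => zx /andP[].
    by rewrite ltNge zx.
have Ic : \int[m]_w G w = zseries c.
  apply/esym; apply: (zseries_eq sc).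
  rewrite (_ : zpartial c = fun n =>
      \int[m]_(w in `](i - n%:Z)%:~R * h, (i + n%:Z)%:~R * h]) G w); last first.
    apply/funext => n; rewrite -PsiE// -zpartial_telescope; congr zpartial.
    by apply/funext => j; rewrite PsiE.
  apply/cvgrPdist_le => e e0.
  have K10 : 0 < K + 1 by rewrite ltr_wpDl.
  have /cvgrPdist_le/(_ _ (divr_gt0 e0 K10)) := grid_mass_cvg i.
  apply: filterS => n hn.
  set D : set (measurableTypeR R) := `](i - n%:Z)%:~R * h, (i + n%:Z)%:~R * h]%classic.
  have mD : measurable D by exact: measurable_itv.
  have mDC : measurable (~` D) by exact: measurableC.
  have DE : fine (m (~` D)) = B - (Fg (i + n%:Z) - Fg (i - n%:Z)).
    rewrite /Fg distribution_functionB// -/D /total_mass -(setUv D) measureU//; last exact: setICr.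
    by rewrite fineD ?fin_num_measure// addrAC subrr add0r.
  have -> : \int[m]_w G w - \int[m]_(w in D) G w = \int[m]_(w in ~` D) G w.
    rewrite -(setUv D) Rintegral_setU//; first by rewrite addrAC subrr add0r.
      by rewrite setUv.
    by apply/disj_setPS; rewrite setICr.
  apply: (@le_trans _ _ (\int[m]_(w in ~` D) cst K w)).
    apply: norm_Rintegral_le; [exact: mDC|exact: measurable_funTS| |].
      exact: finite_measure_integrable_cst.
    by move=> w _; exact: GK.
  rewrite Rintegral_cst// DE.
  have h1 : B - (Fg (i + n%:Z) - Fg (i - n%:Z)) <= e / (K + 1).
    exact: le_trans (ler_norm _) hn.
  apply: le_trans (ler_wpM2l K0 h1) _.
  rewrite mulrCA ler_piMr ?(ltW e0)// ler_pdivrMr// mul1r; lra.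
rewrite Ic -(zseriesB sc sa).
have eps0 : 0 <= eps.
  apply: le_trans (normr_ge0 _) (Ga 0 ((i - 0)%:~R * h) _).
  by rewrite lexx andbT ltr_pM2r// ltr_int; lia.
apply: zseries_le; apply: zsummable_leW (tel eps eps0) => j.
rewrite -mC.
have -> : c j - fine (m (C j)) * a j = \int[m]_(w in C j) (G w - cst (a j) w).
  rewrite RintegralB ?Rintegral_cst//; [by rewrite mulrC|exact: measurable_itv..].
have -> : eps * fine (m (C j)) = \int[m]_(w in C j) cst eps w.
  by rewrite Rintegral_cst//; exact: measurable_itv.
apply: norm_Rintegral_le; [exact: measurable_itv| | |].
- by apply: measurable_funB => //; exact: measurable_funTS.
- exact: cst_int.
- by move=> w; rewrite /C/= in_itv/=; exact: Ga.
Qed.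

End FiniteMeasure.
End RiemannSums.

(** * Consistency of the scheme *)
Section BoundedVariationKernel.
Variable R : realType.
Local Notation mu := (@lebesgue_measure R).
Variables (m1 m2 : {finite_measure set (measurableTypeR R) -> \bar R}) (beta : R -> R).
Local Notation F1 := (distribution_function m1).
Local Notation F2 := (distribution_function m2).
Hypothesis betaF : forall x, beta x = F1 x - F2 x.
Hypothesis beta_L1 : mu.-integrable setT (EFin \o beta).

Definition variation_function (x : R) : R := F1 x + F2 x.
Local Notation V := variation_function.
Definition total_variation_mass : R := total_mass m1 + total_mass m2.
Local Notation B := total_variation_mass.

Lemma variation_function_bounds (x : R) : 0 <= V x <= B.
Proof.
have /andP[a1 a2] := distribution_function_bounds m1 x.
have /andP[b1 b2] := distribution_function_bounds m2 x.
by rewrite /V /B; apply/andP; split; lra.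
Qed.

Lemma total_variation_mass_ge0 : 0 <= B.
Proof. by rewrite addr_ge0 ?total_mass_ge0. Qed.

Lemma beta_variation (x y : R) : x <= y -> `|beta y - beta x| <= V y - V x.
Proof.
move=> xy; rewrite !betaF /V.
have h1 := distribution_function_le m1 xy; have h2 := distribution_function_le m2 xy.
by rewrite ler_norml; apply/andP; split; lra.
Qed.

Let mbeta : measurable_fun setT beta.
Proof. by case/integrableP : beta_L1 => /measurable_EFinP. Qed.

(** On a cell, |beta| at the right end point is at most its mean plus the
    variation of beta over the cell.  The means add up to the L^1 norm divided
    by h, and the variations telescope. *)
Lemma beta_grid_summable (h : R) (i : int) : 0 < h ->
  exists M : R, zsummable_le (fun j => beta ((i - j)%:~R * h)) M.
Proof.
move=> h0.
have ibeta : mu.-integrable setT (EFin \o (fun y => `|beta y|)) := integrable_norm beta_L1.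
pose Phi (k : int) := \int[mu]_(y in `]-oo, k%:~R * h]) `|beta y| + h * V (k%:~R * h).
pose N := \int[mu]_y `|beta y|.
have PhiB k : 0 <= Phi k <= N + h * B.
  have /andP[v0 v1] := variation_function_bounds (k%:~R * h).
  apply/andP; split.
    by apply: addr_ge0; [exact: Rintegral_ge0|rewrite mulr_ge0// ltW].
  apply: lerD; last by rewrite ler_wpM2l// ltW.
  rewrite /N Rintegral_mkcond; apply: le_Rintegral => //.
    rewrite -restrict_EFin; apply/integrable_restrict => //.
    by rewrite setTI; apply: integrableS ibeta.
  by move=> y _; rewrite patchE; case: ifP => _; [exact: lexx|exact: normr_ge0].
have cell (k : int) : h * `|beta (k%:~R * h)| <= Phi k - Phi (k - 1).
  have kk : (k - 1)%:~R * h <= k%:~R * h :> R by rewrite ler_wpM2r ?(ltW h0)// ler_int; lia.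
  set a := (k - 1)%:~R * h in kk *; set b := k%:~R * h in kk *.
  have ba : b - a = h by rewrite /a /b intrB mulrBl mul1r; ring.
  have mab : mu `]a, b]%classic = (b - a)%:E.
    rewrite /= lebesgue_measure_itv/= lte_fin; case: ltP => // ab.
    by rewrite (_ : b - a = 0)//; apply/eqP; rewrite subr_eq0 eq_le ab kk.
  have icell : mu.-integrable `]a, b] (EFin \o (fun y => `|beta y|)).
    by apply: integrableS ibeta => //; exact: measurable_itv.
  have icst (c : R) : mu.-integrable `]a, b] (EFin \o cst c).
    apply/integrableP; split; first exact/measurable_EFinP.
    have -> : (\int[mu]_(x in `]a, b]) `|(EFin \o cst c) x| =
        \int[mu]_(x in `]a, b]) (cst `|c|%:E) x)%E.
      by [].
    rewrite integral_cst; last exact: measurable_itv.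
    by rewrite [X in (_ * X)%E](_ : _ = (b - a)%:E) -?EFinM ?ltry//; exact: mab.
  have Icst (c : R) : \int[mu]_(y in `]a, b]) cst c y = c * h.
    rewrite Rintegral_cst; last exact: measurable_itv.
    congr (_ * _); transitivity (fine (b - a)%:E); [congr fine; exact: mab|exact: ba].
  have PhiE : Phi k - Phi (k - 1) = \int[mu]_(y in `]a, b]) `|beta y| + h * (V b - V a).
    have : \int[mu]_(y in `]-oo, b]) `|beta y| = \int[mu]_(y in `]-oo, a]) `|beta y| +
        \int[mu]_(y in `]a, b]) `|beta y|.
      rewrite -Rintegral_setU//.
      - by rewrite -itv_bndbnd_setU.
      - by rewrite -itv_bndbnd_setU//; apply: integrableS ibeta.
      - apply/disj_setPS => z /= []; rewrite !in_itv/= => zx /andP[].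
        by rewrite ltNge zx.
    by rewrite /Phi -/a -/b => ->; ring.
  rewrite PhiE.
  have -> : h * `|beta b| = \int[mu]_(y in `]a, b]) cst (`|beta b|) y by rewrite Icst mulrC.
  have -> : h * (V b - V a) = \int[mu]_(y in `]a, b]) cst (V b - V a) y by rewrite Icst mulrC.
  rewrite -RintegralD//; apply: le_Rintegral => //.
    exact: (integrableD _ icell (icst _)).
  move=> y /=; rewrite in_itv/= => /andP[ay yb].
  have h1 := beta_variation yb.
  have /andP[h2 h3] := variation_function_bounds y.
  have h4 : V a <= V y.
    have := beta_variation (ltW ay); have := normr_ge0 (beta y - beta a); lra.
  have : `|beta b| <= `|beta y| + `|beta b - beta y|.
    by rewrite -[X in `|X| <= _](subrK (beta y)) addrC ler_normD.
  lra.
exists (h^-1 * (N + h * B)).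
apply: (@zsummable_leW _ _ (fun j => h^-1 * (Phi (i - j) - Phi (i - j - 1)))).
  by move=> j; rewrite ler_pdivlMl.
move=> n.
have -> : zpartial (fun j => h^-1 * (Phi (i - j) - Phi (i - j - 1))) n =
    h^-1 * zpartial (fun j => Phi (i - j) - Phi (i - j - 1)) n.
  by rewrite /zpartial big_distrr; apply: eq_bigr => k _; rewrite /= -mulrDr.
rewrite zpartial_telescope ler_wpM2l ?invr_ge0 ?(ltW h0)//.
by have := PhiB (i + n%:Z); have := PhiB (i - n%:Z) => /andP[? ?] /andP[? ?]; lra.
Qed.

Section Convolution.
Variables (g : R -> R) (K L : R).
Hypotheses (mg : measurable_fun setT g) (gK : forall y, `|g y| <= K)
  (gL : forall y z, `|g y - g z| <= L * `|y - z|).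

Let integrable_conv (x : R) : mu.-integrable setT (EFin \o (fun y => beta (x - y) * g y)).
Proof.
have ib := integrable_reflect x (integrable_norm beta_L1).
apply: (integrable_dominated measurableT _ (integrableZl measurableT K ib)).
  apply: measurable_funM => //; apply: measurableT_comp => //.
  exact: measurable_funB.
by move=> y _ /=; rewrite normrM mulrC ler_wpM2r.
Qed.

Let S (x : R) := \int[m1]_w g (x - w) - \int[m2]_w g (x - w).

Lemma convolution_increment (x eta : R) : 0 < eta ->
  `|convolution beta g (x + eta) - convolution beta g x - eta * S x| <= L * eta ^+ 2 * B.
Proof.
move=> eta0; rewrite /convolution -RintegralB//.
have -> : \int[mu]_y (beta (x + eta - y) * g y - beta (x - y) * g y) =
  \int[mu]_y (g y * (F1 (x + eta - y) - F1 (x - y))) -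
  \int[mu]_y (g y * (F2 (x + eta - y) - F2 (x - y))).
  rewrite -RintegralB//.
  - by apply: eq_Rintegral => y _; rewrite !betaF; ring.
  - exact: (integrable_increment m1 x mg gK eta0).
  - exact: (integrable_increment m2 x mg gK eta0).
have h1 := increment_estimate m1 x mg gK gL eta0.
have h2 := increment_estimate m2 x mg gK gL eta0.
move: h1 h2; rewrite /S /B.
set I1 := (X in `|X - eta * _| <= _ -> _ -> _).
set I2 := (X in _ -> `|X - eta * _| <= _ -> _).
set J1 := \int[m1]_w _; set J2 := \int[m2]_w _.
move=> h1 h2; rewrite mulrBr.
have -> : I1 - I2 - (eta * J1 - eta * J2) = (I1 - eta * J1) - (I2 - eta * J2) by ring.
by rewrite mulrDr (le_trans (ler_normB _ _))// lerD.
Qed.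

(** The derivative is assumed to exist, so its value can be computed from
    increments to the right. *)
Lemma convolution_derivative (x : R) : derivable (convolution beta g) x 1 ->
  (convolution beta g)^`()%classic x = S x.
Proof.
move=> /cvg_ex[/= D hD].
rewrite derive1E /derive (cvg_lim _ hD)//.
apply/eqP; rewrite -subr_eq0 -normr_le0; apply/ler_addgt0Pr => e e0; rewrite add0r.
have e20 : 0 < e / 2 by rewrite divr_gt0.
move/cvgrPdist_le : hD => /(_ _ e20)/nbhs_ballP[d /= d0 hd].
have L0 : 0 <= L.
  have := gL 1 0; rewrite subr0 normr1 mulr1; exact: le_trans.
have LB1 : 0 < L * B + 1 by rewrite ltr_wpDl// mulr_ge0// total_variation_mass_ge0.
(* The second bound makes the error L B eta of the quotient at most e / 2. *)
pose eta := Num.min (d / 2) (e / 2 / (L * B + 1)).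
have eta0 : 0 < eta by rewrite lt_min !divr_gt0.
have etad : eta < d by rewrite gt_min ltr_pdivrMr// ltr_pMr// ltr1n.
have etae : eta * (L * B + 1) <= e / 2 by rewrite -ler_pdivlMr// ge_min lexx orbT.
have := hd eta; rewrite /ball/= sub0r normrN gtr0_norm// => /(_ etad).
have eta_neq0 : eta != 0 by rewrite gt_eqF.
move=> /(_ eta_neq0); rewrite /GRing.scale/= mulr1 addrC => h1.
have h2 := convolution_increment x eta0; rewrite addrC in h1.
set Q := convolution beta g (x + eta) - convolution beta g x in h2.
have h3 : `|D - eta^-1 * Q| <= e / 2 by rewrite /Q (addrC x).
have h4 : `|eta^-1 * Q - S x| <= e / 2.
  have -> : eta^-1 * Q - S x = eta^-1 * (Q - eta * S x) by field.
  rewrite normrM gtr0_norm ?invr_gt0// mulrC ler_pdivrMr// (le_trans h2)//.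
  by have := ltW eta0; move: etae; nra.
have -> : D - S x = (D - eta^-1 * Q) + (eta^-1 * Q - S x) by ring.
by rewrite (le_trans (ler_normD _ _))//; lra.
Qed.

(** The centered difference is the mean of a forward and a backward difference.
    Each of them is a Riemann sum for the integral of g(x_i - w) over cells of
    which the node x_i - x_j is an end point. *)
Lemma truncation_error (h : R) (i : int) : 0 < h ->
  derivable (convolution beta g) (i%:~R * h) 1 ->
  `|(convolution beta g)^`()%classic (i%:~R * h) -
    zseries (fun j => difference_kernel beta h i j * g (j%:~R * h))| <= L * h * B.
Proof.
move=> h0 /convolution_derivative ->.
have L0 : 0 <= L.
  have := gL 1 0; rewrite subr0 normr1 mulr1; exact: le_trans.
pose G (w : R) := g (i%:~R * h - w).
have mG : measurable_fun setT G.
  by apply: measurableT_comp => //; apply: measurable_funB.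
have GK w : `|G w| <= K by exact: gK.
have aK (j : int) : `|g (j%:~R * h)| <= K by exact: gK.
pose k (s : int) (m : {finite_measure set (measurableTypeR R) -> \bar R}) (j : int) :=
  (distribution_function m ((i + s - j)%:~R * h) -
   distribution_function m ((i + s - j - 1)%:~R * h)) * g (j%:~R * h).
have est (s : int) (m : {finite_measure set (measurableTypeR R) -> \bar R}) : (s == 0) || (s == 1) ->
    zsummable_le (k s m) (K * total_mass m) /\
    `|\int[m]_w G w - zseries (k s m)| <= L * h * total_mass m.
  move=> s01; apply: (@riemann_sum_estimate R m h h0 G K (L * h) (i + s)
    (fun j : int => g (j%:~R * h)) mG GK aK) => j w /andP[w1 w2].
  apply: le_trans (gL _ _) _; rewrite ler_wpM2l//.
  move: w1 w2; rewrite !(intrB, intrD) => w1 w2.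
  by rewrite ler_norml; case/orP : s01 w1 w2 => /eqP -> w1 w2; apply/andP; split; lra.
have [s01 e01] := est 0 m1 isT; have [s11 e11] := est 1 m1 isT.
have [s02 e02] := est 0 m2 isT; have [s12 e12] := est 1 m2 isT.
have sA := zsummable_leB s11 s12; have sB := zsummable_leB s01 s02.
have E : zseries (fun j => difference_kernel beta h i j * g (j%:~R * h)) =
   2^-1 * (zseries (k 1 m1) - zseries (k 1 m2)) + 2^-1 * (zseries (k 0 m1) - zseries (k 0 m2)).
  rewrite -(zseriesB s11 s12) -(zseriesB s01 s02).
  have sN := zsummable_leZ (-1) sB.
  rewrite -mulrDr -[X in _ * (_ + X)]opprK.
  rewrite -[X in _ * (_ - X)]mulN1r -(zseriesZ (-1) sB).
  rewrite -(zseriesB sA sN) -(zseriesZ _ (zsummable_leB sA sN)).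
  congr zseries; apply/funext => j; rewrite /difference_kernel !betaF /k.
  have -> : i + 1 - j - 1 = i - j by lia.
  have -> : i + 0 - j - 1 = i - 1 - j by lia.
  have -> : i + 0 - j = i - j by lia.
  by field.
rewrite E /S /B -/G.
set I1 := \int[m1]_w _; set I2 := \int[m2]_w _.
have -> : I1 - I2 - (2^-1 * (zseries (k 1 m1) - zseries (k 1 m2)) +
    2^-1 * (zseries (k 0 m1) - zseries (k 0 m2)))
  = (2^-1 * ((I1 - zseries (k 1 m1)) + (I1 - zseries (k 0 m1)))) -
    (2^-1 * ((I2 - zseries (k 1 m2)) + (I2 - zseries (k 0 m2)))) by field.
apply: le_trans (ler_normB _ _) _.
rewrite !normrM (ger0_norm (_ : 0 <= 2^-1 :> R)) ?invr_ge0//.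
have := ler_normD (I1 - zseries (k 1 m1)) (I1 - zseries (k 0 m1)).
have := ler_normD (I2 - zseries (k 1 m2)) (I2 - zseries (k 0 m2)).
move: e01 e11 e02 e12; rewrite -/I1 -/I2; lra.
Qed.

End Convolution.
End BoundedVariationKernel.

(** * Curves in Sobolev and sequence spaces *)
Section Curves.
Variable R : realType.

(** The family ev consists of linear functionals controlled by the norm N:
    evaluations at integers for bounded sequences, values and difference
    quotients for functions in H^s. *)
Lemma C1_curve_uniform_derivative (X Y : Type) (E : set (X -> R)) (N : (X -> R) -> \bar R)
    (I : set R) (v v' : R -> X -> R) (ev : Y -> (X -> R) -> R) (c : R) :
  C1_curve E N I v v' -> 0 < c ->
  (forall y (a b z : X -> R) (k : R),
     ev y (fun x => (a x - b x) / k - z x) = (ev y a - ev y b) / k - ev y z) ->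
  (forall r t, I r -> I t -> forall e : R,
     (N (fun x => (v r x - v t x) / (r - t) - v' t x)%R < e%:E)%E ->
     forall y, `|ev y (fun x => (v r x - v t x) / (r - t) - v' t x)| <= c * e) ->
  uniform_derivative I (fun t y => ev y (v t)) (fun t y => ev y (v' t)).
Proof.
move=> hv c0 lin ctrl t It e e0.
have [_ _ hq _] := hv t It.
have ec0 : 0 < e / c by rewrite divr_gt0.
have := cvge0_lt hq ec0 => /(_ _) h.
have {}h : \forall r \near t^', I r ->
    (N (fun x => (v r x - v t x) / (r - t) - v' t x)%R < (e / c)%:E)%E.
  exact: h.
move: h => /nbhs_ballP[d /= d0 hd].
exists d => // r Ir rd y.
have [->|rt] := eqVneq r t.
  by rewrite !subrr mul0r subr0 normr0 mulr0.
have rt0 : r - t != 0 by rewrite subr_eq0.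
have := ctrl r t Ir It (e / c) (hd r _ rt Ir) y.
rewrite lin [in X in _ <= X]mulrC divfK ?gt_eqF// => hh.
have -> : ev y (v r) - ev y (v t) - (r - t) * ev y (v' t) =
  ((ev y (v r) - ev y (v t)) / (r - t) - ev y (v' t)) * (r - t) by field.
rewrite normrM ler_wpM2r//; apply: hh.
by rewrite /ball/= distrC.
Qed.

Lemma linf_norm_lt (w : int -> R) (e : R) : (linf_norm w < e%:E)%E -> forall i, `|w i| <= e.
Proof.
move=> h i; rewrite -lee_fin; apply: le_trans (ltW h).
by apply: ereal_sup_ubound; exists i.
Qed.

Lemma linf_norm_le (w : int -> R) (e : R) : (forall i, `|w i| <= e) -> (linf_norm w <= e%:E)%E.
Proof. by move=> h; apply: ge_ereal_sup => _ [i _ <-]; rewrite lee_fin. Qed.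

Lemma linf_bounded (w : int -> R) : linf w -> exists M : R, forall i, `|w i| <= M.
Proof.
rewrite /linf/=; case E : (linf_norm w) => [r| |]// _.
  by exists (r + 1); apply: linf_norm_lt; rewrite E lte_fin ltrDl.
by exists 0; apply: linf_norm_lt; rewrite E ltNyr.
Qed.

Lemma bounded_linf (w : int -> R) (M : R) : (forall i, `|w i| <= M) -> linf w.
Proof. by move=> h; rewrite /linf/= (le_lt_trans (linf_norm_le h))// ltry. Qed.

Lemma linf_curve_uniform_derivative (I : set R) (v v' : R -> int -> R) :
  C1_curve (@linf R) (@linf_norm R) I v v' -> uniform_derivative I v v'.
Proof.
move=> hv.
apply: (@C1_curve_uniform_derivative _ int _ _ _ _ _ (fun i w => w i) 1 hv ltr01) => //.
by move=> r t _ _ e he i; rewrite mul1r; exact: (linf_norm_lt he i).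
Qed.

Lemma sobolev_bounded (s : R) (v : R -> R) : 2 <= s -> sobolev s v ->
  exists M : R, (forall x, `|v x| <= M) /\ (forall x y, `|v x - v y| <= M * `|x - y|).
Proof.
move=> s2 [cv]; case E : (sobolev_norm s v) => [r| |]// _.
  by exists (2 * (r + 1)); apply: (sobolev_embedding s2 cv); rewrite E lte_fin ltrDl.
by exists (2 * 1); apply: (sobolev_embedding s2 cv); rewrite E ltNyr.
Qed.

Definition difference_quotient (p : R * R) (v : R -> R) : R := (v p.1 - v p.2) / (p.1 - p.2).

Lemma difference_quotient_le (v : R -> R) (M : R) : 0 <= M ->
  (forall x y, `|v x - v y| <= M * `|x - y|) -> forall p, `|difference_quotient p v| <= M.
Proof.
move=> M0 h [x y]; rewrite /difference_quotient /=.
have [->|xy] := eqVneq x y; first by rewrite subrr mul0r normr0.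
by rewrite normrM normfV ler_pdivrMr ?normr_gt0 ?subr_eq0.
Qed.

Section SobolevCurve.
Variables (s T : R) (u u' : R -> R -> R).
Hypotheses (s2 : 2 <= s)
  (hu : C1_curve (sobolev s) (sobolev_norm s) `[0, T] u u').

Let quotient_continuous r t : `[0, T]%classic r -> `[0, T]%classic t ->
  continuous (fun x => (u r x - u t x) / (r - t) - u' t x).
Proof.
move=> Ir It x.
have [[c1 _] _ _ _] := hu Ir; have [[c2 _] [c3 _] _ _] := hu It.
apply: cvgB; last exact: c3.
by apply: cvgM; [apply: cvgB; [exact: c1|exact: c2]|exact: cvg_cst].
Qed.

Lemma sobolev_curve_uniform_derivative : uniform_derivative `[0, T] u u'.
Proof.
have c0 : 0 < 2 :> R by [].
apply: (@C1_curve_uniform_derivative _ R _ _ _ _ _ (fun x v => v x) 2 hu c0) => // r t Ir It e he y.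
exact: (sobolev_embedding s2 (quotient_continuous Ir It) he).1.
Qed.

(** The difference quotients form a curve of functions of pairs of points; so
    compactness in time bounds the Lipschitz constants as it bounds the values. *)
Lemma sobolev_curve_bounds : exists M : R, 0 <= M /\ forall t, t \in `[0, T] ->
  (forall x, `|u t x| <= M) /\ (forall x y, `|u t x - u t y| <= M * `|x - y|).
Proof.
have bnd (w : R -> R) : sobolev s w -> exists M : R, (forall x, `|w x| <= M) /\
    (forall p, `|difference_quotient p w| <= M).
  move=> /(sobolev_bounded s2)[M [M1 M2]]; exists M; split => // p.
  by apply: difference_quotient_le => //; exact: le_trans (normr_ge0 _) (M1 0).
have d1 := sobolev_curve_uniform_derivative.
have d2 : uniform_derivative `[0, T] (fun t p => difference_quotient p (u t))
    (fun t p => difference_quotient p (u' t)).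
  have c0 : 0 < 2 :> R by [].
  apply: (@C1_curve_uniform_derivative _ (R * R) _ _ _ _ _ difference_quotient 2 hu c0).
    by move=> p a b z k; rewrite /difference_quotient; ring.
  move=> r t Ir It e he p; apply: difference_quotient_le.
    have := (sobolev_embedding s2 (quotient_continuous Ir It) he).1 0.
    exact: le_trans.
  exact: (sobolev_embedding s2 (quotient_continuous Ir It) he).2.
have [| |M1 hM1] := uniform_derivative_bounded d1.
- by move=> t It; have [h _ _ _] := hu It; have [M [hM _]] := bnd _ h; exists M.
- by move=> t It; have [_ h _ _] := hu It; have [M [hM _]] := bnd _ h; exists M.
have [| |M2 hM2] := uniform_derivative_bounded d2.
- by move=> t It; have [h _ _ _] := hu It; have [M [_ hM]] := bnd _ h; exists M.
- by move=> t It; have [_ h _ _] := hu It; have [M [_ hM]] := bnd _ h; exists M.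
exists (`|M1| + `|M2|); split; first exact: addr_ge0.
move=> t It; split=> [x|x y].
  apply: le_trans (hM1 t It x) _; rewrite (le_trans (ler_norm _))// lerDl//.
have [->|xy] := eqVneq x y; first by rewrite !subrr normr0 mulr0.
have := hM2 t It (x, y); rewrite /difference_quotient/= normrM normfV.
rewrite ler_pdivrMr ?normr_gt0 ?subr_eq0// => /le_trans; apply.
by rewrite ler_wpM2r// (le_trans (ler_norm _))// lerDr.
Qed.

End SobolevCurve.

Lemma class_C_lipschitz (k : nat) (f : R -> R) (M : R) : (1 < k)%N -> class_C k f ->
  exists Lam : R, 0 <= Lam /\ forall x y, `|x| <= M -> `|y| <= M -> `|f x - f y| <= Lam * `|x - y|.
Proof.
move=> k1 [df _].
have df0 (x : R) : derivable f x 1 by exact: (df 0%N (ltnW k1)).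
have cdf : continuous f^`()%classic.
  by move=> x; apply/differentiable_continuous/derivable1_diffP; exact: (df 1%N k1).
have [N hN] : exists N : R, forall x, x \in `[- M, M] -> `|f^`()%classic x| <= N.
  have := @compact_bounded R R^o (f^`()%classic @` `[- M, M]%classic).
  move=> []; first by apply: continuous_compact; [exact: continuous_subspaceT|exact: segment_compact].
  move=> N [_ hN]; exists (N + 1) => x xM; apply: (hN (N + 1)); first by rewrite ltrDl.
  by exists x.
exists `|N|; split => // x y.
wlog yx : x y / y <= x => [H xM yM|xM yM].
  by have [yx|/ltW xy] := leP y x; [exact: H|rewrite distrC (distrC x); exact: H].
have cf : continuous f.
  by move=> z; apply/differentiable_continuous/derivable1_diffP.
have [||z zyx ->] := @MVT_segment R f f^`()%classic y x yx.
- by move=> z _; rewrite derive1E; exact/derivableP.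
- exact: continuous_subspaceT.
rewrite normrM ler_wpM2r// (le_trans _ (ler_norm N))//; apply: hN.
move: zyx xM yM; rewrite !in_itv/= !ler_norml => /andP[? ?] /andP[? ?] /andP[? ?].
by apply/andP; split; lra.
Qed.

Definition clip (M x : R) : R := Num.max (- M) (Num.min x M).

Lemma clip_id (M x : R) : `|x| <= M -> clip M x = x.
Proof. by rewrite ler_norml /clip => /andP[h1 h2]; rewrite (min_idPl h2) (max_idPr h1). Qed.

Lemma clip_le (M x : R) : 0 <= M -> `|clip M x| <= M.
Proof.
move=> M0; rewrite ler_norml /clip le_max lexx/= ge_max ge_min lexx orbT andbT; lra.
Qed.

Lemma clip_lipschitz (M x y : R) : `|clip M x - clip M y| <= `|x - y|.
Proof.
have mx (a p q : R) : `|Num.max a p - Num.max a q| <= `|p - q|.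
  have h1 := ler_norm (p - q); have h2 := ler_norm (- (p - q)); rewrite normrN in h2.
  by case: (leP a p) => ?; case: (leP a q) => ?; rewrite ler_norml; apply/andP; split; lra.
have mn (a p q : R) : `|Num.min p a - Num.min q a| <= `|p - q|.
  have h1 := ler_norm (p - q); have h2 := ler_norm (- (p - q)); rewrite normrN in h2.
  by case: (leP p a) => ?; case: (leP q a) => ?; rewrite ler_norml; apply/andP; split; lra.
exact: le_trans (mx _ _ _) (mn _ _ _).
Qed.

End Curves.

(** * Solutions of the semidiscrete problem *)
(** A solution of p' = Phi(p) with bounded and Lipschitz continuous derivative,
    with moduli of differentiability and continuity that are independent of i. *)
Definition quadratic_flow (R : realType) (Phi : (int -> R) -> int -> R) (C0 C1 : R)
    (p : R -> int -> R) : Prop :=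
  forall t r : R, 0 <= t -> 0 <= r -> forall i,
    [/\ `|Phi (p t) i| <= C0,
        `|p r i - p t i - (r - t) * Phi (p t) i| <= C1 * (r - t) ^+ 2
      & `|Phi (p r) i - Phi (p t) i| <= C1 * (`|r - t| * (1 + `|r - t|))].

Section SemidiscreteProblem.
Variable R : realType.
Variables (beta V f phi : R -> R) (B h : R).
Hypotheses (h0 : 0 < h) (B0 : 0 <= B) (V0 : forall x, 0 <= V x <= B)
  (betaV : forall x y, x <= y -> `|beta y - beta x| <= V y - V x)
  (beta_sum : forall i : int, exists M : R, zsummable_le (fun j => beta ((i - j)%:~R * h)) M).

Lemma lipschitz_on_bounded (g : R -> R) (M Lam : R) : 0 <= M ->
  (forall x y, `|x| <= M -> `|y| <= M -> `|g x - g y| <= Lam * `|x - y|) ->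
  forall x, `|x| <= M -> `|g x| <= `|g 0| + `|Lam| * M.
Proof.
move=> M0 gL x xM; have := gL x 0 xM; rewrite normr0 subr0 => /(_ M0) h1.
have -> : g x = g 0 + (g x - g 0) by ring.
rewrite (le_trans (ler_normD _ _))// lerD2l (le_trans h1)//.
apply: le_trans (ler_wpM2r (normr_ge0 x) (ler_norm Lam)) _.
by rewrite ler_wpM2l.
Qed.

(** The projection makes the right-hand side bounded and globally Lipschitz, so
    that Picard iteration needs no a priori bound. *)
Lemma clipped_solution (M Lam : R) : 0 <= M -> 0 <= Lam ->
  (forall x y, `|x| <= M -> `|y| <= M -> `|f x - f y| <= Lam * `|x - y|) ->
  exists C0 C1 : R, [/\ 0 <= C0, 0 <= C1 & exists p : R -> int -> R, p 0 = grid h phi /\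
    quadratic_flow (semidiscrete_rhs beta (f \o clip M) h) C0 C1 p].
Proof.
move=> M0 Lam0 fL.
pose Kf := `|f 0| + `|Lam| * M.
have Kf0 : 0 <= Kf by rewrite addr_ge0// mulr_ge0.
have fK (v : int -> R) j : `|(f \o clip M) (v j)| <= Kf.
  by apply: (lipschitz_on_bounded M0 fL); exact: clip_le.
pose Phi (v : int -> R) := semidiscrete_rhs beta (f \o clip M) h v.
pose C0 := B * Kf; have C00 : 0 <= C0 by rewrite mulr_ge0.
pose L := B * Lam + 1; have L0 : 0 < L by rewrite ltr_wpDl// mulr_ge0.
have PhiM (v : int -> R) i : `|Phi v i| <= C0.
  exact: (semidiscrete_rhs_bound h0 V0 betaV beta_sum).
have PhiL (v w : int -> R) (K : R) : (forall i, `|v i - w i| <= K) ->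
    forall i, `|Phi v i - Phi w i| <= L * K.
  move=> vw i; have K0 : 0 <= K by exact: le_trans (normr_ge0 _) (vw 0).
  apply: (@le_trans _ _ (B * (Lam * K))); last by rewrite /L; lra.
  apply: (semidiscrete_rhs_lipschitz h0 V0 betaV beta_sum) => // j /=.
  apply: le_trans (fL _ _ (clip_le _ M0) (clip_le _ M0)) _.
  by rewrite ler_wpM2l// (le_trans (clip_lipschitz _ _ _)).
have [p [p0 pE]] := picard_existence (grid h phi) L0 PhiL PhiM.
have L00 := ltW L0.
exists C0, (L * C0 * (1 + L)); split => //.
  by rewrite !mulr_ge0// addr_ge0.
exists p; split => // t r t0 r0 i; split.
- exact: PhiM.
- apply: le_trans (pE t r t0 r0 i) _; rewrite ler_wpM2r ?sqr_ge0//.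
  by rewrite ler_peMr ?mulr_ge0// lerDl.
- have pd j : `|p r j - p t j| <= C0 * `|r - t| + L * C0 * `|r - t| ^+ 2.
    have -> : p r j - p t j = (r - t) * Phi (p t) j + (p r j - p t j - (r - t) * Phi (p t) j) by ring.
    rewrite (le_trans (ler_normD _ _))// lerD//.
      by rewrite normrM mulrC ler_wpM2r.
    by rewrite real_normK ?num_real//; exact: pE.
  apply: le_trans (PhiL _ _ _ pd i) _.
  have d0 := normr_ge0 (r - t); move: (Num.norm (r - t)) d0 => d d0.
  have e1 : 0 <= L * C0 by rewrite mulr_ge0.
  have := mulr_ge0 (mulr_ge0 e1 d0) L00; have := mulr_ge0 (mulr_ge0 e1 d0) d0.
  lra.
Qed.

Lemma semidiscrete_rhs_clip (M : R) (v : int -> R) : (forall i, `|v i| <= M) ->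
  semidiscrete_rhs beta (f \o clip M) h v = semidiscrete_rhs beta f h v.
Proof.
move=> vM; rewrite /semidiscrete_rhs.
rewrite (_ : (f \o clip M) \o v = f \o v)//.
by apply/funext => i /=; rewrite clip_id.
Qed.

Lemma linf_norm_ge0 (w : int -> R) : (0 <= linf_norm w)%E.
Proof.
apply: (@le_trans _ _ (`|w 0|%:E)); first by rewrite lee_fin.
by apply: ereal_sup_ubound; exists 0.
Qed.

Lemma quadratic_flow_solution (M C0 C1 tau : R) (p : R -> int -> R) :
  0 <= C1 -> p 0 = grid h phi ->
  (forall t : R, 0 <= t < tau -> forall i, `|p t i| <= M) ->
  quadratic_flow (semidiscrete_rhs beta (f \o clip M) h) C0 C1 p ->
  is_semidiscrete_solution beta f phi h tau%:E p.
Proof.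
move=> C10 p0 pM pE; split; first by move=> i; rewrite p0.
move=> t [/= t0]; rewrite lte_fin => ttau.
have tI : 0 <= t < tau by rewrite t0.
have rhsE (r : R) : 0 <= r < tau ->
    semidiscrete_rhs beta f h (p r) = semidiscrete_rhs beta (f \o clip M) h (p r).
  by move=> rI; rewrite semidiscrete_rhs_clip//; exact: pM.
have C11 : 0 < C1 + 1 by rewrite ltr_wpDl.
split.
- exact: bounded_linf (pM t tI).
- rewrite rhsE//; apply: (@bounded_linf _ _ C0) => i.
  by have [] := pE t t t0 t0 i.
- apply: cvge0_le => [r|e e0]; first exact: linf_norm_ge0.
  apply/nbhs_ballP; exists (e / (C1 + 1)) => /=; first exact: divr_gt0.
  move=> r rd rt [/= r0]; rewrite lte_fin => rtau.
  have rt0 : r - t != 0 by rewrite subr_eq0.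
  apply: linf_norm_le => i; rewrite rhsE//.
  have [_ + _] := pE t r t0 r0 i; set w := semidiscrete_rhs _ _ _ _ _ => pq.
  have -> : (p r i - p t i) / (r - t) - w = (p r i - p t i - (r - t) * w) / (r - t) by field.
  rewrite normrM normfV ler_pdivrMr ?normr_gt0// (le_trans pq)//.
  rewrite -real_normK ?num_real// expr2 mulrA ler_wpM2r//.
  move: rd; rewrite /ball/= distrC ltr_pdivlMr// => rd.
  by have := normr_ge0 (r - t); lra.
- apply: cvge0_le => [r|e e0]; first exact: linf_norm_ge0.
  pose d := Num.min 1 (e / (C1 + 1) / 2).
  apply/nbhs_ballP; exists d => /=; first by rewrite lt_min ltr01 !divr_gt0.
  move=> r; rewrite /ball/= distrC lt_min => /andP[rd1 rd2] [/= r0]; rewrite lte_fin => rtau.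
  apply: linf_norm_le => i; rewrite !rhsE ?r0//.
  have [_ _ pq] := pE t r t0 r0 i; apply: le_trans pq _.
  move: rd2; rewrite ltr_pdivlMr// ltr_pdivlMr// => rd2.
  have d0 := normr_ge0 (r - t); move: (Num.norm (r - t)) d0 rd1 rd2 => z z0 z1 z2.
  have : C1 * (z * (1 + z)) <= C1 * (z * 2) by rewrite !ler_wpM2l//; lra.
  by lra.
Qed.

Lemma semidiscrete_unique (M Lam tau : R) (p q : R -> int -> R) : 0 <= M -> 0 <= Lam -> 0 <= tau ->
  (forall x y, `|x| <= M -> `|y| <= M -> `|f x - f y| <= Lam * `|x - y|) ->
  uniform_derivative `[0, tau] p (fun t => semidiscrete_rhs beta f h (p t)) ->
  uniform_derivative `[0, tau] q (fun t => semidiscrete_rhs beta f h (q t)) ->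
  (forall t : R, t \in `[0, tau] -> forall i, `|p t i| <= M) ->
  (forall t : R, t \in `[0, tau] -> forall i, `|q t i| <= M) ->
  p 0 =1 q 0 -> p tau =1 q tau.
Proof.
move=> M0 Lam0 tau0 fL dp dq pM qM pq0 i.
have fK := lipschitz_on_bounded M0 fL.
have L0 : 0 < B * Lam + 1 by rewrite ltr_wpDl// mulr_ge0.
have tt : tau \in `[0, tau] by rewrite in_itv/= tau0 lexx.
have := @gronwall R int tau 0 (B * Lam + 1) _ _ tau0 (lexx _) L0
  (uniform_derivativeB dp dq) _ _ _ tau tt i.
rewrite mulr0 !mul0r normr_le0 subr_eq0 => H; apply/eqP; apply: H.
- by move=> j; rewrite pq0 subrr.
- exists (M + M) => t tI j; rewrite (le_trans (ler_normB _ _))// lerD//; [exact: pM|exact: qM].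
- move=> t S /andP[t0 ttau] hS j; rewrite add0r.
  have tI : t \in `[0, tau] by rewrite in_itv/= !ltW.
  have S0 : 0 <= S by exact: le_trans (normr_ge0 _) (hS 0).
  apply: (@le_trans _ _ (B * (Lam * S))); last by lra.
  apply: (semidiscrete_rhs_lipschitz h0 V0 betaV beta_sum
    (Kv := `|f 0| + `|Lam| * M) (Kw := `|f 0| + `|Lam| * M)).
  + by move=> k; apply: fK; exact: pM.
  + by move=> k; apply: fK; exact: qM.
  + move=> k; apply: le_trans (fL _ _ (pM _ tI k) (qM _ tI k)) _.
    by rewrite ler_wpM2l.
Qed.

End SemidiscreteProblem.

(** * The error estimate *)
Section Convergence.
Variable R : realType.

(** This is the Jordan decomposition, evaluated on half lines. *)
Lemma charge_primitive_decomposition (beta : R -> R)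
    (mu : {charge set (measurableTypeR R) -> \bar R}) :
  (forall x, (beta x)%:E = mu [set` `]-oo, x]]) ->
  exists m1 m2 : {finite_measure set (measurableTypeR R) -> \bar R},
    forall x, beta x = distribution_function m1 x - distribution_function m2 x.
Proof.
move=> betaE; have [P [N PN]] := Hahn_decomposition mu.
exists (jordan_pos PN), (jordan_neg PN) => x.
have mx : measurable (`]-oo, x]%classic : set (measurableTypeR R)) by exact: measurable_itv.
have := betaE x; rewrite (jordan_decomp PN mx) /cadd/= cscaleN1.
rewrite /distribution_function => E; rewrite -fineB ?fin_num_measure//.
by rewrite -[LHS]/(fine (beta x)%:E) E.
Qed.

Section ErrorEstimate.
Variables (m1 m2 : {finite_measure set (measurableTypeR R) -> \bar R}) (beta : R -> R).
Hypotheses (betaF : forall x, beta x = distribution_function m1 x - distribution_function m2 x)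
  (beta_L1 : lebesgue_measure.-integrable [set: R] (EFin \o beta)).
Local Notation B := (total_variation_mass m1 m2).
Variables (s T M Lam : R) (f phi : R -> R) (u : R -> R -> R).
Hypotheses (s2 : 2 <= s) (T0 : 0 < T) (M0 : 0 <= M) (Lam0 : 0 <= Lam)
  (cf : continuous f)
  (fL : forall x y, `|x| <= M + 1 -> `|y| <= M + 1 -> `|f x - f y| <= Lam * `|x - y|)
  (uM : forall t : R, t \in `[0, T] ->
     (forall x, `|u t x| <= M) /\ (forall x y, `|u t x - u t y| <= M * `|x - y|))
  (u_sol : is_solution s T beta f phi u).

(** In Gronwall's inequality for the error, consistency gives the constant
    delta and stability the constant Lam.  The projection does not affect the
    values of u, which are at most M. *)
Lemma semidiscrete_error (h C0 C1 : R) (p : R -> int -> R) : 0 < h -> 0 <= C0 -> 0 <= C1 ->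
  p 0 = grid h phi ->
  quadratic_flow (semidiscrete_rhs beta (f \o clip (M + 1)) h) C0 C1 p ->
  forall t : R, t \in `[0, T] -> forall i,
    `|grid h (u t) i - p t i| <= 2 * (Lam * M * h * B) * T * expR (2 * (B * Lam + 1) * T).
Proof.
move=> h0 C00 C10 p0 pE.
have [ut [hu ueq u0]] := u_sol.
have B0 := total_variation_mass_ge0 m1 m2.
have M10 : 0 <= M + 1 by rewrite addr_ge0.
have T0' := ltW T0.
have zT : 0 \in `[0, T] by rewrite in_itv/= lexx.
have L0 : 0 < B * Lam + 1 by rewrite ltr_wpDl// mulr_ge0.
pose rhs t := semidiscrete_rhs beta (f \o clip (M + 1)) h (p t).
have dp : uniform_derivative `[0, T] p rhs.
  move=> t /=; rewrite in_itv/= => /andP[t0 tT] e e0.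
  have C11 : 0 < C1 + 1 by rewrite ltr_wpDl.
  exists (e / (C1 + 1)); first exact: divr_gt0.
  move=> r; rewrite in_itv/= => /andP[r0 rT] rt i.
  have [_ + _] := pE t r t0 r0 i; move=> H; apply: le_trans H _.
  rewrite -real_normK ?num_real// expr2 mulrA ler_wpM2r//.
  move: rt; rewrite ltr_pdivlMr// => rt.
  by have := normr_ge0 (r - t); lra.
have du := uniform_derivative_comp (fun i : int => i%:~R * h) (sobolev_curve_uniform_derivative s2 hu).
have de := uniform_derivativeB du dp.
have uM1 (t : R) : t \in `[0, T] -> forall x, `|u t x| <= M + 1.
  by move=> tI x; rewrite (le_trans ((uM tI).1 x))// lerDl.
have p0E i : p 0 i = u 0 (i%:~R * h) by rewrite p0 /grid u0.
have delta0 : 0 <= Lam * M * h * B by rewrite !mulr_ge0// ltW.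
have := gronwall T0' delta0 L0 de; apply.
- by move=> i; rewrite p0E subrr.
- exists (M + (M + T * C0 + C1 * T ^+ 2)) => t tI i.
  have := tI; rewrite in_itv/= => /andP[t0 tT].
  rewrite (le_trans (ler_normB _ _))// lerD//; first exact: (uM tI).1.
  have [c0 + _] := pE 0 t (lexx _) t0 i; have [{}c0 _ _] := pE 0 0 (lexx _) (lexx _) i.
  rewrite !subr0 => c1.
  have -> : p t i = p 0 i + t * semidiscrete_rhs beta (f \o clip (M + 1)) h (p 0) i
     + (p t i - p 0 i - t * semidiscrete_rhs beta (f \o clip (M + 1)) h (p 0) i) by ring.
  rewrite (le_trans (ler_normD _ _))// lerD//.
    rewrite (le_trans (ler_normD _ _))// lerD//; first by rewrite p0E; exact: (uM zT).1.
    by rewrite normrM (ger0_norm t0) ler_pM.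
  by apply: le_trans c1 _; rewrite ler_wpM2l// lerXn2r ?nnegrE.
- move=> t S /andP[t0 tT] hS i.
  have tI : t \in `[0, T] by rewrite in_itv/= !ltW.
  have S0 : 0 <= S by exact: le_trans (normr_ge0 _) (hS 0).
  have V0 := variation_function_bounds m1 m2.
  have bV := beta_variation betaF.
  have bS : forall i : int, exists M : R, zsummable_le (fun j => beta ((i - j)%:~R * h)) M.
    by move=> k; exact: (beta_grid_summable betaF beta_L1 k h0).
  pose Kf := `|f 0| + `|Lam| * (M + 1).
  have fK (v : int -> R) j : `|(f \o clip (M + 1)) (v j)| <= Kf.
    by apply: (lipschitz_on_bounded M10 fL); exact: clip_le.
  have fu j : f (u t (j%:~R * h)) = (f \o clip (M + 1)) (grid h (u t) j).
    by rewrite /grid/= clip_id//; exact: uM1.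
  have tT' : 0 < t <= T by rewrite t0 ltW.
  have [dcv /eqP] := ueq t (i%:~R * h) tT'; rewrite addr_eq0 => /eqP utE.
  have [cu _] : sobolev s (u t) by have [] := hu t tI.
  have mfu : measurable_fun setT (f \o u t).
    by apply: continuous_measurable_fun => x; apply: continuous_comp; [exact: cu|exact: cf].
  have fuK y : `|(f \o u t) y| <= Kf.
    by apply: (lipschitz_on_bounded M10 fL); exact: uM1.
  have fuL y z : `|(f \o u t) y - (f \o u t) z| <= Lam * M * `|y - z|.
    rewrite (le_trans (fL (uM1 _ tI _) (uM1 _ tI _)))// -mulrA ler_wpM2l//.
    exact: (uM tI).2.
  have tr := truncation_error betaF beta_L1 mfu fuK fuL h0 dcv.
  have rE := semidiscrete_rhsE h0 bS i (fK (grid h (u t))).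
  have lip : `|semidiscrete_rhs beta (f \o clip (M + 1)) h (grid h (u t)) i - rhs t i|
      <= B * (Lam * S).
    apply: (semidiscrete_rhs_lipschitz h0 V0 bV bS (Kv := Kf) (Kw := Kf)) => // j.
    apply: le_trans (fL (clip_le _ M10) (clip_le _ M10)) _.
    rewrite ler_wpM2l// (le_trans (clip_lipschitz _ _ _))//; exact: hS.
  rewrite utE.
  set D := (convolution _ _)^`()%classic _ in tr *.
  set Z := zseries _ in tr.
  have ZE : semidiscrete_rhs beta (f \o clip (M + 1)) h (grid h (u t)) i = - Z.
    by rewrite rE /Z; congr (- zseries _); apply/funext => j; rewrite -fu.
  have -> : - D - rhs t i =
      (semidiscrete_rhs beta (f \o clip (M + 1)) h (grid h (u t)) i - rhs t i) - (D - Z).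
    by rewrite ZE; ring.
  rewrite (le_trans (ler_normB _ _))//.
  have : B * (Lam * S) <= (B * Lam + 1) * S by lra.
  by move: lip tr; lra.
Qed.

End ErrorEstimate.

End Convergence.

Theorem theorem4p1 (R : realType) (beta : R -> R)
    (mu : {charge set (measurableTypeR R) -> \bar R}) (s T : R) (f phi : R -> R)
    (u : R -> R -> R) (uh : R -> R -> int -> R) (Th : R -> \bar R)
    (beta_L1 : lebesgue_measure.-integrable [set: R] (EFin \o beta))
    (beta_mu : distributional_derivative beta mu)
    (betaE : forall x, (beta x)%:E = mu [set` `]-oo, x]])
    (s_gt : 5 / 2 < s)
    (f_C : class_C (Num.truncn s).+1 f)
    (f0 : f 0 = 0)
    (T_gt0 : 0 < T)
    (phi_Hs : sobolev s phi)
    (u_sol : is_solution s T beta f phi u)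
    (uh_sol : forall h, 0 < h ->
       is_maximal_semidiscrete_solution beta f phi h (Th h) (uh h)) :
  exists h0 C : R, 0 < h0 /\
    forall h, 0 < h <= h0 ->
      (T%:E <= Th h)%E /\
      forall t, 0 <= t <= T ->
        (linf_norm (fun i => grid h (u t) i - uh h t i)%R <= (C * h)%:E)%E.
Proof.
have [m1 [m2 betaF]] := charge_primitive_decomposition betaE.
have s2 : 2 <= s by lra.
have k1 : (1 < (Num.truncn s).+1)%N.
  by rewrite ltnS truncn_gt0; lra.
have cf : continuous f.
  move=> x; apply/differentiable_continuous/derivable1_diffP.
  by case: f_C => + _; move=> /(_ 0%N isT x).
have [ut [hu ueq u0]] := u_sol.
have [M [M0 uM]] := sobolev_curve_bounds s2 hu.
have [Lam [Lam0 fL]] := class_C_lipschitz (M + 1) k1 f_C.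
have M10 : 0 <= M + 1 by rewrite addr_ge0.
pose B := total_variation_mass m1 m2.
have B0 : 0 <= B := total_variation_mass_ge0 m1 m2.
have V0 := variation_function_bounds m1 m2.
have bV := beta_variation betaF.
pose C := 2 * (Lam * M * B) * T * expR (2 * (B * Lam + 1) * T).
have C0 : 0 <= C.
  by rewrite !mulr_ge0 ?expR_ge0 ?(ltW T_gt0).
(* The first witness ensures C h <= 1/2, which keeps p below M + 1/2. *)
exists ((2 * (C + 1))^-1), C; split; first by rewrite invr_gt0 mulr_gt0// ltr_wpDl.
move=> h /andP[h0 hle].
have Ch : C * h <= 2^-1.
  have : h * (2 * (C + 1)) <= 1 by rewrite -ler_pdivlMr ?mul1r ?mulr_gt0 ?ltr_wpDl.
  by lra.
have bS : forall i : int, exists M : R, zsummable_le (fun j => beta ((i - j)%:~R * h)) M.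
  by move=> k; exact: (beta_grid_summable betaF beta_L1 k h0).
have [K0 [K1 [K00 K10 [p [p0 pE]]]]] := clipped_solution phi h0 B0 V0 bV bS M10 Lam0 fL.
have err (t : R) : 0 <= t <= T -> forall i, `|grid h (u t) i - p t i| <= C * h.
  move=> tI i.
  have tI' : t \in `[0, T] by rewrite in_itv.
  apply: le_trans (semidiscrete_error betaF beta_L1 s2 T_gt0 M0 Lam0 cf fL uM u_sol
    h0 K00 K10 p0 pE tI' i) _.
  by rewrite /C -/B; lra.
have pM (t : R) : 0 <= t <= T -> forall i, `|p t i| <= M + 2^-1.
  move=> tI i; have tI' : t \in `[0, T] by rewrite in_itv.
  have -> : p t i = grid h (u t) i - (grid h (u t) i - p t i) by ring.
  rewrite (le_trans (ler_normB _ _))// lerD//; first exact: (uM _ tI').1.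
  exact: le_trans (err t tI i) Ch.
have TT : 0 <= T <= T by rewrite lexx ltW.
(* During a time d after T, the solution p moves by at most 1/2. *)
pose d := Num.min 1 (2 * (K0 + K1 + 1))^-1.
have K2 : 0 < 2 * (K0 + K1 + 1) by rewrite mulr_gt0// ltr_wpDl// addr_ge0.
have d0 : 0 < d by rewrite lt_min ltr01 invr_gt0.
have pMd (t : R) : 0 <= t < T + d -> forall i, `|p t i| <= M + 1.
  move=> /andP[t0 td] i; have [tT|Tt] := leP t T.
    by rewrite (le_trans (pM t _ i)) ?t0// lerD2l; lra.
  have T0' := ltW T_gt0.
  have [_ + _] := pE T t T0' t0 i; have [a1 _ _] := pE T T T0' T0' i.
  set w := semidiscrete_rhs _ _ _ _ _ in a1 * => a2.
  have -> : p t i = p T i + ((t - T) * w + (p t i - p T i - (t - T) * w)) by ring.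
  rewrite (le_trans (ler_normD _ _))//.
  have h1 := pM T TT i.
  have h2 : `|(t - T) * w + (p t i - p T i - (t - T) * w)| <= 2^-1.
    rewrite (le_trans (ler_normD _ _))// normrM.
    have tT0 : 0 < t - T by rewrite subr_gt0.
    have dd : t - T <= d by lra.
    have dd1 : t - T <= 1 by rewrite (le_trans dd)// ge_min lexx.
    have dd2 : (t - T) * (2 * (K0 + K1 + 1)) <= 1.
      by rewrite -ler_pdivlMr// div1r (le_trans dd)// ge_min lexx orbT.
    rewrite (gtr0_norm tT0).
    have e1 : (t - T) * `|w| <= (t - T) * K0 by rewrite ler_wpM2l// ltW.
    have e2 : K1 * (t - T) ^+ 2 <= K1 * (t - T).
      by rewrite ler_wpM2l// expr2 ler_piMr// ltW.
    lra.
  lra.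
have solp : is_semidiscrete_solution beta f phi h (T + d)%:E p.
  exact: (quadratic_flow_solution K10 p0 pMd pE).
have [Th0 [uh0 uhC] maxh] := uh_sol h h0.
have [p0' pC] := solp.
have agree (t : R) : 0 <= t -> t < T + d -> (t%:E < Th h)%E -> p t =1 uh h t.
  move=> t0 tTd tTh.
  have sub1 : `[0, t]%classic `<=` [set t : R | 0 <= t /\ (t%:E < (T + d)%:E)%E].
    move=> r /=; rewrite in_itv/= => /andP[r0 rt]; split => //.
    by rewrite lte_fin (le_lt_trans rt).
  have sub2 : `[0, t]%classic `<=` [set t : R | 0 <= t /\ (t%:E < Th h)%E].
    move=> r /=; rewrite in_itv/= => /andP[r0 rt]; split => //.
    by rewrite (le_lt_trans _ tTh)// lee_fin.
  have dp := uniform_derivativeS sub1 (linf_curve_uniform_derivative pC).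
  have dq := uniform_derivativeS sub2 (linf_curve_uniform_derivative uhC).
  have [||M1 hM1] := uniform_derivative_bounded dq.
  - by move=> r rI; have [h1 _ _ _] := uhC r (sub2 r rI); exact: linf_bounded.
  - by move=> r rI; have [_ h1 _ _] := uhC r (sub2 r rI); exact: linf_bounded.
  pose M2 := M + 1 + `|M1|.
  have M20 : 0 <= M2 by rewrite addr_ge0.
  have [Lam2 [Lam20 fL2]] := class_C_lipschitz M2 k1 f_C.
  apply: (semidiscrete_unique h0 B0 V0 bV bS M20 Lam20 t0 fL2 dp dq).
  - move=> r; rewrite in_itv/= => /andP[r0 rt] i; rewrite (le_trans (pMd r _ i))//.
      by rewrite r0 (le_lt_trans rt).
    by rewrite /M2 lerDl.
  - move=> r rI i; rewrite (le_trans (hM1 r rI i))// (le_trans (ler_norm _))//.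
    by rewrite /M2 lerDr.
  - by move=> i; rewrite p0' uh0.
have long : ((T + d)%:E <= Th h)%E.
  rewrite leNgt; apply/negP => short.
  apply: (maxh _ p short solp) => t t0 tTh; apply: agree => //.
  by rewrite -lte_fin (lt_trans tTh).
split.
  by apply: le_trans long; rewrite lee_fin lerDl ltW.
move=> t /andP[t0 tT].
have tTd : t < T + d by rewrite (le_lt_trans tT)// ltrDl.
have tTh : (t%:E < Th h)%E by rewrite (lt_le_trans _ long)// lte_fin.
apply: linf_norm_le => i; rewrite -(agree t t0 tTd tTh i).
by apply: err; rewrite t0.
Qed.
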